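(* Let $S$ be a unilateral weighted shift on a complex Hilbert space $\mathcal{H}$ with orthonormal basis $(e_n)_{n\ge 0}$ and bounded weight sequence $(\omega_n)_{n\ge 0}$ of positive real numbers, i.e. $Se_n=\omega_n e_{n+1}$ for all $n\ge 0$. If $S$ possesses Bishop's property $(\beta)$, then $r_1(S)=r(S)$. Conversely, if $r_1(S)=r(S)$, then either $S$ possesses Bishop's property $(\beta)$, or $\sigma_\beta(S)=\{\lambda\in\mathbb{C}:|\lambda|=r(S)\}$.
   Context: For a bounded linear operator $T$ on $\mathcal{H}$: $r(T)$ is the spectral radius, $m(T)=\inf\{\|Tx\|:\|x\|=1\}$, and $r_1(T)=\sup_{n\ge1}[m(T^n)]^{1/n}=\lim_{n\to\infty}[m(T^n)]^{1/n}$. For open $U\subset\mathbb{C}$, $\mathcal{O}(U,\mathcal{H})$ is the Fréchet space of analytic $\mathcal{H}$-valued functions on $U$ with the topology of uniform convergence on compact subsets, and $T_U:\mathcal{O}(U,\mathcal{H})\to\mathcal{O}(U,\mathcal{H})$ is $T_Uf(\lambda)=(T-\lambda)f(\lambda)$. $T$ possesses Bishop's property $(\beta)$ if for every open $U\subset\mathbb{C}$ the map $T_U$ is injective with closed range; equivalently, for every open $U$ and every sequence $(f_n)$ in $\mathcal{O}(U,\mathcal{H})$, $T_Uf_n\to0$ in $\mathcal{O}(U,\mathcal{H})$ implies $f_n\to0$ in $\mathcal{O}(U,\mathcal{H})$. $T$ possesses Bishop's property $(\beta)$ at $\lambda_0\in\mathbb{C}$ if there is an open neighbourhood $V$ of $\lambda_0$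 such that for every open $U\subset V$ the map $T_U$ is injective with closed range. $\sigma_\beta(T)$ is the set of $\lambda\in\mathbb{C}$ at which $T$ fails to possess Bishop's property $(\beta)$. *)

(* Defs.v *)
From HB Require Import structures.
From mathcomp Require Import all_boot all_order all_algebra.
From mathcomp Require Import all_classical all_reals all_analysis.
From mathcomp Require Import complex.

Set Implicit Arguments.
Unset Strict Implicit.
Unset Printing Implicit Defensive.

Import Order.TTheory GRing.Theory Num.Theory.
Import numFieldNormedType.Exports.

Local Open Scope classical_set_scope.
Local Open Scope ring_scope.

Notation conjugation R := (@Num.conj R[i]).

Section HilbertOperators.
Context {R : realType} {H : completeNormedModType R[i]}.
(* [R[i]^o] is [R[i]] seen as a topological space and as a normed module over
   itself. *)
Local Notation C := R[i]^o.

(* The norm of a normed module over [R[i]] takes its values in [R[i]]; they are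
   nonnegative reals, so taking the real part loses nothing. *)
Definition rnorm {V : normedModType R[i]} (x : V) : R := complex.Re `|x|.

(* A complete normed space is a Hilbert space when its norm is the one induced
   by an inner product (linear in the first argument). *)
Definition is_hilbert (dot : {dot H for conjugation R}) : Prop :=
  forall x : H, `|x| ^+ 2 = dot x x.

Definition orthonormal_basis (dot : {dot H for conjugation R}) (e : nat -> H)
  : Prop :=
  (forall i j, dot (e i) (e j) = (i == j)%:R) /\
  closure [set x | exists (n : nat) (a : nat -> R[i]),
                     x = \sum_(i < n) a i *: e i] = [set: H].

Definition bounded_operator (T : H -> H) : Prop :=
  exists M : R, forall x, rnorm (T x) <= M * rnorm x.

Definition weighted_shift (e : nat -> H) (w : nat -> R) (S : {linear H -> H})
  : Prop :=
  bounded_operator S /\ forall n, S (e n) = (w n)%:C%C *: e n.+1.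

Definition spectrum (T : H -> H) : set C :=
  [set z | ~ exists B : {linear H -> H},
       [/\ bounded_operator B,
           forall x, B (T x - z *: x) = x &
           forall x, T (B x) - z *: B x = x]].

Definition spectral_radius (T : H -> H) : R :=
  sup [set rnorm z | z in spectrum T].

Definition lower_norm (T : H -> H) : R :=
  inf [set rnorm (T x) | x in [set x | rnorm x = 1]].

Definition lower_radius (T : H -> H) : R :=
  sup [set lower_norm (iter n T) `^ n%:R^-1 | n in [set n | (1 <= n)%N]].

(* [analytic_functions U] represents O(U, H): an analytic function on [U] is
   extended by 0 outside [U], so that equality of representatives is equality
   on [U].  Analytic means complex differentiable at every point of [U] (the
   increment in [derivable f z 1] ranges over [R[i]]). *)
Definition analytic_functions (U : set C) : set (C -> H) :=
  [set f | (forall z, U z -> derivable f z 1) /\ (forall z, ~ U z -> f z = 0)].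

Definition compacts_in (U : set C) : set (set C) :=
  [set K | compact K /\ K `<=` U].

(* T_U; it does not depend on [U] thanks to the extension by 0. *)
Definition pointwise_shift (T : H -> H) (f : C -> H) : C -> H :=
  fun z => T (f z) - z *: f z.

Definition injective_on (T : H -> H) (U : set C) : Prop :=
  set_inj (analytic_functions U) (pointwise_shift T).

(* The range of T_U is closed in O(U, H), for the topology of uniform
   convergence on the compact subsets of [U]. *)
Definition closed_range_on (T : H -> H) (U : set C) : Prop :=
  let range_TU := pointwise_shift T @` analytic_functions U in
  analytic_functions U `&`
    closure (range_TU : set {family compacts_in U, C -> H}) `<=` range_TU.

Definition bishop_beta (T : H -> H) : Prop :=
  forall U : set C, open U -> injective_on T U /\ closed_range_on T U.

Definition bishop_beta_at (T : H -> H) (z0 : C) : Prop :=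
  exists V : set C, open_nbhs z0 V /\
    forall U : set C, open U -> U `<=` V ->
      injective_on T U /\ closed_range_on T U.

Definition sigma_beta (T : H -> H) : set C := [set z | ~ bishop_beta_at T z].

End HilbertOperators.

(* Main.v *)
Require Import Defs.
From HB Require Import structures.
From mathcomp Require Import all_boot all_order all_algebra.
From mathcomp Require Import all_classical all_reals all_analysis.
From mathcomp Require Import complex.
From mathcomp Require Import ring lra.
Import Order.TTheory GRing.Theory Num.Theory.
Import numFieldNormedType.Exports.
Local Open Scope classical_set_scope.
Local Open Scope ring_scope.

Set Implicit Arguments.
Unset Strict Implicit.
Unset Printing Implicit Defensive.


(** Let [beta n] be the product of the first [n] weights, so that [S^n] sends
[e k] to [beta (k + n) / beta k *: e (k + n)], and write [r1] and [r] for the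
lower radius and the spectral radius of [S].  The growth rates of [beta]
determine both: a lower bound [c * s ^+ n * beta k <= beta (k + n)], uniform in
[k] and [n], forces [s <= r1] ([lower_radius_ge]), and an upper bound
[beta (k + n) <= K * s ^+ n * beta k] forces [r <= s] ([spectral_radius_le]).
Conversely such an upper bound holds for every [s > r], because the
coordinates of the resolvent at [e k] are the numbers
[- beta (k + n) / beta k * z ^- n.+1] ([notin_spectrum_growth]).

From Bishop's property to [r1 = r].  On an annulus [a < |z| < b] consider the
windows [sum over p <= k < q of beta k * z ^- k.+1 *: e k].  The operator [S - z]
telescopes them: only a term at [e p] and a term at [e q] survive.  Multiplied by
[z ^+ j / beta j], a window has a coefficient [1 / z] at [e j], while both
surviving terms are small on the annulus when [beta j] is much larger than
[beta p * b ^+ (j - p)] and than [beta q / a ^+ (q - j)].  If windows existed with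
arbitrarily small surviving terms, a rapidly convergent sum of their images would
be analytic and in the closure of the range, whereas the coefficients of a
preimage would be unbounded.  A closed range therefore gives a constant [K] such
that, for all [p <= j <= q], [beta] grows from [p] to [j] at most at rate [b] up
to [K], or from [j] to [q] at least at rate [a] up to [K]
([closed_range_annulus]).
If [r1 < r], take two disjoint annuli with radii strictly between [r1] and [r].
As the outer one lies below [r], some stretch from [p] to [N] grows faster than
the outer annulus allows; hence [beta] grows from [N] on at least at the rate
[a] of the outer annulus.  Then the first alternative for the inner annulus,
started at [N], is also harmless, and [beta] grows at a rate larger than [r1]
from every index, which is absurd ([bishop_beta_radii]).

From [r1 = r] to the dichotomy.  If [|z| <> r], the operator [S - z] is bounded
below: for [|z| > r] because [z] is outside the spectrum, for [|z| < r1] because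
[S^n - z^n] factors through [S - z].  A uniform lower bound on an open set makes
[S - u] injective with closed range at each point [u], and the preimages of an
analytic function depend analytically on [u] ([bounded_below_derivable]), so
Bishop's property holds at [z].  The diagonal unitary [e k |-> a ^- k *: e k] with
[|a| = 1] conjugates [S] to [a *: S]; hence the set where Bishop's property fails
is invariant under rotation, and it is empty or the whole circle of radius [r].
When it is empty, the unique local preimages glue and Bishop's property holds
([bishop_beta_local]). *)

(** * Real-valued norms *)

Section RealNorm.
Context {R : realType}.
Local Notation C := R[i]^o.
Section Module.
Context {V : normedModType R[i]}.
Implicit Types x y : V.

Lemma normE x : `|x| = (rnorm x)%:C%C.
Proof. by rewrite /rnorm RRe_real// ger0_real. Qed.

Lemma rnorm_ge0 x : 0 <= rnorm x.
Proof. by have := normr_ge0 x; rewrite normE lecR. Qed.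

Lemma rnorm0 : rnorm (0 : V) = 0.
Proof. by rewrite /rnorm normr0. Qed.

Lemma rnorm0_eq0 x : rnorm x = 0 -> x = 0.
Proof. by move=> x0; apply/normr0_eq0; rewrite normE x0. Qed.

Lemma rnormN x : rnorm (- x) = rnorm x.
Proof. by rewrite /rnorm normrN. Qed.

Lemma rnormB x y : rnorm (x - y) = rnorm (y - x).
Proof. by rewrite /rnorm distrC. Qed.

Lemma le_rnormD x y : rnorm (x + y) <= rnorm x + rnorm y.
Proof. by have := ler_normD x y; rewrite !normE -rmorphD lecR. Qed.

Lemma le_rnormB x y : rnorm (x - y) <= rnorm x + rnorm y.
Proof. by rewrite -(rnormN y) le_rnormD. Qed.

Lemma le_rnorm_dist x y : rnorm x <= rnorm (x - y) + rnorm y.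
Proof. by have := le_rnormD (x - y) y; rewrite subrK. Qed.

Lemma le_rnorm_distD x y z : rnorm (x - z) <= rnorm (x - y) + rnorm (y - z).
Proof. by have := le_rnormD (x - y) (y - z); rewrite addrA subrK. Qed.

Lemma rnormZ (a : R[i]) x : rnorm (a *: x) = rnorm (a : C) * rnorm x.
Proof.
rewrite {1}/rnorm normrZ normE (_ : `|a| = (rnorm (a : C))%:C%C) -?rmorphM//.
Qed.

Lemma rnorm_sum (I : Type) (s : seq I) (P : pred I) (F : I -> V) :
  rnorm (\sum_(i <- s | P i) F i) <= \sum_(i <- s | P i) rnorm (F i).
Proof.
elim/big_ind2: _ => [|x a y b xa yb|//]; first by rewrite rnorm0.
by rewrite (le_trans (le_rnormD _ _))// lerD.
Qed.

End Module.

Lemma rnormM (a b : C) : rnorm (a * b : C) = rnorm a * rnorm b.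
Proof. exact: rnormZ. Qed.

Lemma rnormr (r : R) : rnorm (r%:C%C : C) = `|r|.
Proof. by rewrite /rnorm normc_def /= expr0n addr0 sqrtr_sqr. Qed.

Lemma rnorm1 : rnorm (1 : C) = 1.
Proof. by rewrite /rnorm normr1. Qed.

Lemma rnormX (a : C) n : rnorm (a ^+ n : C) = rnorm a ^+ n.
Proof. by elim: n => [|n ih]; rewrite ?expr0 ?rnorm1// !exprS rnormM ih. Qed.

Lemma rnormV (a : C) : rnorm (a^-1 : C) = (rnorm a)^-1.
Proof.
have [->|a0] := eqVneq a 0; first by rewrite invr0 rnorm0 invr0.
have na0 : rnorm a != 0 by apply: contra a0 => /eqP/rnorm0_eq0 ->.
by apply: (mulIf na0); rewrite mulVf// -rnormM mulVf// rnorm1.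
Qed.

Lemma rnorm_gt0 {V : normedModType R[i]} (x : V) : (0 < rnorm x) = (x != 0).
Proof.
rewrite lt_def rnorm_ge0 andbT; congr negb.
by apply/eqP/eqP => [/rnorm0_eq0//|->]; exact: rnorm0.
Qed.

Lemma Re_le_rnorm (a : C) : complex.Re a <= rnorm a.
Proof.
case: a => a b; rewrite /rnorm normc_def /=.
apply: (le_trans (ler_norm _)); rewrite -sqrtr_sqr ler_wsqrtr//.
by rewrite lerDl sqr_ge0.
Qed.

End RealNorm.

Section Limits.
Context {R : realType} {V : normedModType R[i]}.
Local Notation C := R[i]^o.

Lemma gt0_complexE (e : R[i]) : 0 < e -> exists2 r : R, 0 < r & e = r%:C%C.
Proof.
move=> e0; exists (complex.Re e); last by rewrite RRe_real// gtr0_real.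
by move: e0; case: e => a b; rewrite ltcE /= => /andP[].
Qed.

Lemma nbhs_rnormP (x : V) (A : set V) :
  nbhs x A <-> exists2 r : R, 0 < r & forall y, rnorm (y - x) < r -> A y.
Proof.
split=> [/nbhs_ballP[e /= /gt0_complexE[r r0 ->]] xA|[r r0 xA]].
  exists r => // y yx; apply: xA; rewrite -ball_normE /= normE.
  by rewrite ltcR rnormB.
apply/nbhs_ballP; exists r%:C%C; first by rewrite /= ltcR.
by move=> y; rewrite -ball_normE /= normE ltcR rnormB; exact: xA.
Qed.

Lemma closure_rnormP (A : set V) (x : V) :
  closure A x <-> forall r : R, 0 < r -> exists2 y, A y & rnorm (y - x) < r.
Proof.
split=> [Ax r r0|h B /nbhs_rnormP[r r0 xB]].
  by have [|y [Ay yx]] := Ax [set y | rnorm (y - x) < r];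
    [apply/nbhs_rnormP; exists r|exists y].
by have [y Ay yx] := h r r0; exists y; split=> //; exact: xB.
Qed.

Lemma cvg_rnormP (T : Type) (F : set_system T) (FF : Filter F) (f : T -> V)
    (l : V) :
  f x @[x --> F] --> l <->
  forall r : R, 0 < r -> \forall x \near F, rnorm (f x - l) < r.
Proof.
split=> [fl r r0|h A /nbhs_rnormP[r r0 lA]].
  by apply: (fl [set y | rnorm (y - l) < r]); apply/nbhs_rnormP; exists r.
by apply: filterS (h r r0) => x; exact: lA.
Qed.

End Limits.

Section Complete.
Context {R : realType} {V : completeNormedModType R[i]}.

Lemma rnorm_cauchy_cvg (u : nat -> V) :
  (forall r : R, 0 < r -> exists N, forall m n, (N <= m)%N -> (N <= n)%N ->
     rnorm (u m - u n) < r) ->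
  exists l, forall r : R, 0 < r -> exists N, forall n, (N <= n)%N ->
     rnorm (u n - l) < r.
Proof.
move=> h; have /cvg_ex[l /cvg_rnormP ul] : cvgn u.
  apply: cauchy_cvg; apply: cauchy_exP => e /gt0_complexE[r r0 ->].
  have [N hN] := h r r0; exists (u N); exists N => // n /= Nn.
  by rewrite -ball_normE /= normE ltcR hN.
by exists l => r /ul[N _ hN]; exists N.
Qed.

End Complete.

(** * Complex differentiability *)

Section ComplexDerivative.
Context {R : realType}.
Local Notation C := R[i]^o.
Context {V : normedModType R[i]}.
Implicit Types (f : C -> V) (z : C).

(** The form of differentiability used for all estimates below: a real
first-order error bound instead of a filter on the complex numbers. *)
Lemma derivable_rnormP f z :
  derivable f z 1 <->
  exists D : V, forall r : R, 0 < r -> exists2 d : R, 0 < d &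
    forall h : C, rnorm h < d ->
      rnorm (f (z + h) - f z - (h : R[i]) *: D) <= r * rnorm h.
Proof.
have quotE (h : C) D : h != 0 -> f (z + h) - f z - (h : R[i]) *: D =
    (h : R[i]) *: ((h : R[i])^-1 *: (f ((h : R[i]) *: (1 : C) + z) - f z) - D).
  move=> h0; rewrite scalerBr scalerA divff// scale1r.
  by rewrite [(h : R[i]) *: (1 : C)]mulr1 [h + z]addrC.
split=> [/cvg_ex[D /cvg_rnormP fD]|[D fD]].
- exists D => r r0; have /nbhs_rnormP[d d0 hd] := fD r r0.
  exists d => // h hlt; have [->|h0] := eqVneq h 0.
    by rewrite addr0 subrr scale0r subr0 !rnorm0 mulr0.
  rewrite quotE// rnormZ mulrC ler_wpM2r ?rnorm_ge0// ltW//.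
  by apply: (hd h); rewrite ?subr0.
- apply/cvg_ex; exists D; apply/cvg_rnormP => r r0.
  have [|d d0 hd] := fD (r / 2); first by rewrite divr_gt0.
  apply/nbhs_rnormP; exists d => // h; rewrite subr0 => hlt /= h0.
  have := hd h hlt; rewrite quotE// rnormZ mulrC ler_pM2r ?rnorm_gt0//.
  by move/le_lt_trans; apply; rewrite ltr_pdivrMr// ltr_pMr// ltr1n.
Qed.

Lemma eq_on_open_derivable (U : set C) f g z : open U -> U z ->
  (forall u, U u -> f u = g u) -> derivable f z 1 -> derivable g z 1.
Proof.
move=> oU Uz fg; apply: near_eq_derivable.
by apply: filterS (open_nbhs_nbhs (conj oU Uz)); exact: fg.
Qed.

Lemma derivable_scalev (a : C -> C) (v : V) z :
  derivable a z 1 -> derivable (fun u => (a u : R[i]) *: v) z 1.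
Proof.
move=> /derivable1_diffP da; apply/derivable1_diffP.
apply: (@differentiable_comp _ _ _ _ a (fun b : C => (b : R[i]) *: v)) => //.
Qed.

End ComplexDerivative.

(** * Vector-valued power series *)

Lemma expr_eventually_lt {R : realType} (q r : R) : 0 <= q < 1 -> 0 < r ->
  exists N, forall n, (N <= n)%N -> q ^+ n < r.
Proof.
move=> /andP[q0 q1] r0.
have /cvgrPdist_lt/(_ r r0)[N _ hN] : (GRing.exp q : nat -> R) @ \oo --> (0 : R).
  by apply: cvg_expr; rewrite ger0_norm.
by exists N => n /hN; rewrite sub0r normrN ger0_norm ?exprn_ge0.
Qed.

Section AbsoluteConvergence.
Context {R : realType} {V : completeNormedModType R[i]}.

(** The sum exists by completeness; the explicit tail bound is what makes the
convergence uniform when the terms depend on a parameter. *)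
Lemma geometric_series_limit (u : nat -> V) (K : R) : 0 <= K ->
  (forall i, rnorm (u i) <= K * 2^-1 ^+ i) ->
  exists l, forall n, rnorm (l - \sum_(i < n) u i) <= 2 * K * 2^-1 ^+ n.
Proof.
move=> K0 uK; pose s n := \sum_(i < n) u i.
have stail n k : rnorm (s (n + k)%N - s n) <=
    2 * K * (2^-1 ^+ n - 2^-1 ^+ (n + k)).
  elim: k => [|k ih]; first by rewrite addn0 !subrr rnorm0 mulr0.
  rewrite addnS [s _]big_ord_recr/= -/(s _) addrAC.
  apply: (le_trans (le_rnormD _ _)); apply: (le_trans (lerD ih (uK _))).
  rewrite exprS; lra.
have sdist n m : (n <= m)%N -> rnorm (s m - s n) <= 2 * K * 2^-1 ^+ n.
  move=> nm; have := stail n (m - n)%N; rewrite subnKC// => /le_trans; apply.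
  by rewrite ler_wpM2l ?mulr_ge0// gerBl exprn_ge0// invr_ge0.
have [r r0|l sl] := @rnorm_cauchy_cvg _ _ s.
  have r2 : 0 < r / (2 * (2 * K + 1)).
    by rewrite divr_gt0// mulr_gt0// ltr_wpDl ?mulr_ge0.
  have [|N hN] := @expr_eventually_lt R 2^-1 _ _ r2; first by apply/andP; split; lra.
  have : 2 * (2 * K * 2^-1 ^+ N) < r.
    have := hN N (leqnn N); rewrite ltr_pdivlMr ?mulr_gt0 ?ltr_wpDl ?mulr_ge0//.
    have : 0 <= 2^-1 ^+ N :> R by rewrite exprn_ge0// invr_ge0.
    by nra.
  move=> NK; exists N => m n Nm Nn; apply: le_lt_trans NK.
  apply: (le_trans (le_rnorm_distD _ (s N) _)).
  by rewrite mulr_natl mulr2n lerD ?sdist// rnormB sdist.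
exists l => n; apply/ler_addgt0Pr => r r0.
have [N hN] := sl r r0.
apply: (le_trans (le_rnorm_distD _ (s (maxn n N)) _)); rewrite addrC lerD//.
  by rewrite sdist// leq_maxl.
by rewrite rnormB ltW// hN// leq_maxr.
Qed.

End AbsoluteConvergence.

Section PowerSeries.
Context {R : realType} {V : completeNormedModType R[i]}.
Local Notation C := R[i]^o.

(** The second-order remainder of [z ^+ m] is [h ^+ 2] times a polynomial in [z]
and [h] with nonnegative coefficients.  Replacing [z] and [h] by their norms, and
then [rnorm h] by the larger [d] inside that polynomial, can only increase it. *)
Lemma expr_taylor2_le (z h : C) (d : R) m : 0 < d -> rnorm h <= d ->
  rnorm ((z + h) ^+ m.+1 - z ^+ m.+1 - h * (m.+1%:R * z ^+ m) : C) * d ^+ 2 <=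
  rnorm h ^+ 2 * ((rnorm z + d) ^+ m.+1 - rnorm z ^+ m.+1
                  - d * (m.+1%:R * rnorm z ^+ m)).
Proof.
move=> d0 hd; elim: m => [|m ih].
  rewrite !expr1 !expr0 !mulr1.
  have -> : z + h - z - h = 0 :> C by ring.
  have -> : rnorm z + d - rnorm z - d = 0 by ring.
  by rewrite rnorm0 mul0r mulr0.
set E := (X in rnorm X * _) in ih; set x := rnorm z in ih *.
set t := rnorm h in hd ih *.
set F := (X in _ <= _ * X) in ih.
have -> : (z + h) ^+ m.+2 - z ^+ m.+2 - h * (m.+2%:R * z ^+ m.+1) =
    (z + h) * E + h ^+ 2 * (m.+1%:R * z ^+ m) :> C.
  by rewrite /E !exprS -(addn1 m.+1) natrD; ring.
have -> : (x + d) ^+ m.+2 - x ^+ m.+2 - d * (m.+2%:R * x ^+ m.+1) =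
    (x + d) * F + d ^+ 2 * (m.+1%:R * x ^+ m).
  by rewrite /F !exprS -(addn1 m.+1) natrD; ring.
have x0 : 0 <= x := rnorm_ge0 _.
have t0 : 0 <= t := rnorm_ge0 _.
have nm : rnorm (m.+1%:R : C) = m.+1%:R.
  by rewrite -[m.+1%:R](rmorph_nat (real_complex R)) rnormr ger0_norm.
have le1 : rnorm ((z + h) * E + h ^+ 2 * (m.+1%:R * z ^+ m) : C) <=
    (x + t) * rnorm E + t ^+ 2 * (m.+1%:R * x ^+ m).
  apply: (le_trans (le_rnormD _ _)).
  rewrite !rnormM !rnormX.
  rewrite nm.
  by rewrite lerD2r ler_wpM2r ?rnorm_ge0// le_rnormD.
apply: (le_trans (ler_wpM2r (sqr_ge0 _) le1)).
have E0 : 0 <= rnorm E := rnorm_ge0 _.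
have tE : (x + t) * (rnorm E * d ^+ 2) <= (x + d) * (t ^+ 2 * F).
  apply: ler_pM => //; first by rewrite addr_ge0.
    by rewrite mulr_ge0 ?sqr_ge0.
  by rewrite lerD2l.
by rewrite mulrDl -mulrA; nra.
Qed.

(** One of the nonnegative terms of the binomial expansion. *)
Lemma expr_deriv_le (x d : R) m : 0 <= x -> 0 <= d ->
  d * (m.+1%:R * x ^+ m) <= (x + d) ^+ m.+1.
Proof.
move=> x0 d0; elim: m => [|m ih]; first by rewrite !expr1 expr0 !mulr1 lerDr.
have -> : (x + d) ^+ m.+2 = x * (x + d) ^+ m.+1 + d * (x + d) ^+ m.+1.
  by rewrite exprS mulrDl.
have -> : d * (m.+2%:R * x ^+ m.+1) =
    x * (d * (m.+1%:R * x ^+ m)) + d * x ^+ m.+1.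
  by rewrite -[m.+2%:R]natr1 exprS; ring.
apply: lerD; first by rewrite ler_wpM2l.
by rewrite ler_wpM2l// lerXn2r ?nnegrE ?addr_ge0// lerDl.
Qed.

(** Absolute convergence on the circle of radius [rho] gives a quadratic bound on
the first-order remainder inside the disc, by summing [expr_taylor2_le].  The
exponents [m i] are arbitrary, possibly repeated, since the series used later is
not ordered by degree. *)
Lemma power_series_derivable (c : nat -> V) (m : nat -> nat) (rho : R) :
  0 < rho -> (forall i, rnorm (c i) * rho ^+ (m i) <= 2^-1 ^+ i) ->
  exists G : C -> V,
    (forall (z : C) n, rnorm z <= rho ->
       rnorm (G z - \sum_(i < n) (z ^+ m i : R[i]) *: c i) <= 2 * 2^-1 ^+ n) /\
    (forall z : C, rnorm z < rho -> derivable G z 1).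
Proof.
move=> rho0 crho.
have Gex (z : C) : exists l, rnorm z <= rho ->
    forall n, rnorm (l - \sum_(i < n) (z ^+ m i : R[i]) *: c i) <= 2 * 2^-1 ^+ n.
  have [zrho|] := boolP (rnorm z <= rho); last by exists 0.
  have [//|i|l hl] := @geometric_series_limit _ V
     (fun i => (z ^+ m i : R[i]) *: c i) 1.
    rewrite rnormZ mul1r mulrC; apply: le_trans (crho i).
    by rewrite rnormX ler_wpM2l ?rnorm_ge0// lerXn2r ?nnegrE ?rnorm_ge0// ltW.
  by exists l => _ n; have := hl n; rewrite mulr1.
have [G hG] := choice Gex; exists G; split=> [z n /hG//|z zrho].
pose d := rho - rnorm z; have d0 : 0 < d by rewrite subr_gt0.
have zd : rnorm z + d = rho by rewrite /d addrC subrK.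
pose a i : C := if m i is k.+1 then k.+1%:R * z ^+ k else 0.
have an i : d * rnorm (a i) <= rho ^+ m i.
  rewrite /a; case: (m i) => [|k]; first by rewrite rnorm0 mulr0 expr0.
  rewrite rnormM rnormX.
  rewrite -[k.+1%:R](rmorph_nat (real_complex R)) rnormr ger0_norm// -zd.
  by rewrite expr_deriv_le ?rnorm_ge0 ?ltW.
have rem (h : C) i : rnorm h <= d ->
    rnorm ((z + h) ^+ m i - z ^+ m i - h * a i : C) * d ^+ 2 <=
    rnorm h ^+ 2 * rho ^+ m i.
  move=> hd; rewrite /a; case: (m i) => [|k].
    by rewrite !expr0 subrr mulr0 subr0 rnorm0 mul0r mulr1 sqr_ge0.
  apply: (le_trans (expr_taylor2_le z k d0 hd)); rewrite zd.
  rewrite ler_wpM2l ?sqr_ge0// -addrA gerDl -opprD oppr_le0.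
  by rewrite addr_ge0 ?exprn_ge0 ?rnorm_ge0// mulr_ge0 ?mulr_ge0 ?exprn_ge0 ?rnorm_ge0 ?ltW.
have [||D hD] := @geometric_series_limit _ V (fun i => (a i : R[i]) *: c i) d^-1.
- by rewrite invr_ge0 ltW.
- move=> i; rewrite rnormZ mulrC ler_pdivlMl// mulrCA.
  by apply: le_trans (crho i); rewrite ler_wpM2l ?rnorm_ge0.
have quad (h : C) : rnorm h <= d -> 
    rnorm (G (z + h) - G z - (h : R[i]) *: D) <= 2 * (rnorm h / d) ^+ 2.
  move=> hd; apply/ler_addgt0Pr => e e0.
  have zh : rnorm (z + h) <= rho.
    by rewrite (le_trans (le_rnormD _ _))// -zd lerD2l.
  (* [K * 2 ^- N] bounds the total error of the [N]-th partial sums below. *)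
  pose K := 4 + rnorm h * (2 * d^-1).
  have K0 : 0 < K by rewrite ltr_wpDr// !mulr_ge0 ?rnorm_ge0 ?invr_ge0 ?ltW.
  have [||N hN] := @expr_eventually_lt R 2^-1 (e / K); first by apply/andP; split; lra.
    by rewrite divr_gt0.
  have {hN} := hN N (leqnn N); rewrite ltr_pdivlMr// => hN.
  pose s1 := \sum_(i < N) ((z + h) ^+ m i : R[i]) *: c i.
  pose s0 := \sum_(i < N) (z ^+ m i : R[i]) *: c i.
  pose s2 := \sum_(i < N) (a i : R[i]) *: c i.
  have -> : G (z + h) - G z - (h : R[i]) *: D =
     (s1 - s0 - (h : R[i]) *: s2) + ((G (z + h) - s1) - (G z - s0) - (h : R[i]) *: (D - s2)).
    rewrite scalerBr [RHS]addrACA [s1 - s0 + _]addrACA subrKC.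
    by rewrite -!opprD !subrKC.
  apply: (le_trans (le_rnormD _ _)); apply: lerD.
    have -> : s1 - s0 - (h : R[i]) *: s2 =
        \sum_(i < N) ((z + h) ^+ m i - z ^+ m i - h * a i : R[i]) *: c i.
      rewrite /s1 /s0 /s2 scaler_sumr -!sumrB; apply: eq_bigr => i _.
      by rewrite !scalerBl scalerA.
    apply: (le_trans (rnorm_sum _ _ _)).
    apply: (@le_trans _ _ (\sum_(i < N) (rnorm h / d) ^+ 2 * 2^-1 ^+ i)).
      apply: ler_sum => i _; rewrite rnormZ.
      apply: (@le_trans _ _ ((rnorm h / d) ^+ 2 * (rnorm (c i) * rho ^+ m i))).
        rewrite [leRHS]mulrCA [leLHS]mulrC ler_wpM2l ?rnorm_ge0//.
        rewrite exprMn exprVn mulrAC ler_pdivlMr ?exprn_gt0//.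
        exact: rem.
      by rewrite ler_wpM2l ?sqr_ge0.
    rewrite -mulr_sumr mulrC ler_wpM2r ?sqr_ge0//.
    have -> : \sum_(i < N) 2^-1 ^+ i = 2 - 2 * 2^-1 ^+ N :> R.
      elim: (N) => [|k ih]; first by rewrite big_ord0 expr0 mulr1 subrr.
      by rewrite big_ord_recr/= ih exprS; lra.
    by rewrite gerBl mulr_ge0// exprn_ge0// invr_ge0.
  apply: le_trans (ltW hN); apply: (le_trans (le_rnormB _ _)).
  rewrite rnormZ /K mulrDr lerD//.
    apply: (le_trans (le_rnormB _ _)).
    apply: (le_trans (lerD (hG _ zh N) (hG _ (ltW zrho) N))); lra.
  rewrite [leRHS]mulrC -mulrA ler_wpM2l ?rnorm_ge0//.
  exact: (hD N).
apply/derivable_rnormP; exists D => r r0.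
exists (Num.min d (r * d ^+ 2 / 2)).
  by rewrite lt_min d0 divr_gt0// mulr_gt0// exprn_gt0.
move=> h; rewrite lt_min => /andP[/ltW hd hr]; apply: (le_trans (quad h hd)).
rewrite expr_div_n mulrA ler_pdivrMr ?exprn_gt0// expr2 mulrA [leRHS]mulrAC.
rewrite ler_wpM2r ?rnorm_ge0//.
by move: hr; rewrite ltr_pdivlMr// => /ltW; rewrite mulrC.
Qed.

End PowerSeries.

(** * Operators bounded below *)

Section BoundedBelow.
Context {R : realType} {H : completeNormedModType R[i]}.
Local Notation C := R[i]^o.

Definition bounded_below (T : H -> H) (z : C) (c : R) :=
  forall x, c * rnorm x <= rnorm (T x - (z : R[i]) *: x).

Section Operator.
Variables (T : {linear H -> H}) (bT : bounded_operator T).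

Lemma bounded_operatorP : exists2 M : R, 0 < M & forall x, rnorm (T x) <= M * rnorm x.
Proof.
have [M hM] := bT; exists (`|M| + 1); first by rewrite ltr_wpDl.
move=> x; apply: (le_trans (hM x)); rewrite ler_wpM2r ?rnorm_ge0//.
by rewrite (le_trans (ler_norm M))// lerDl.
Qed.

Lemma shiftB (z : C) x y :
  T (x - y) - (z : R[i]) *: (x - y) = T x - (z : R[i]) *: x - (T y - (z : R[i]) *: y).
Proof. by rewrite raddfB/= scalerBr opprD addrACA -opprD. Qed.

(** Approximate preimages of [y] form a Cauchy sequence because [T - z] is bounded
below. *)
Lemma bounded_below_closed_range (z : C) (c : R) (y : H) : 0 < c ->
  bounded_below T z c ->
  (forall r : R, 0 < r -> exists x, rnorm (T x - (z : R[i]) *: x - y) < r) ->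
  exists x, T x - (z : R[i]) *: x = y.
Proof.
move=> c0 hc hy.
have hn n : exists x, rnorm (T x - (z : R[i]) *: x - y) < 2^-1 ^+ n.
  by apply: hy; rewrite exprn_gt0// invr_gt0.
have [u hu] := choice hn.
have half01 : 0 <= (2^-1 : R) < 1 by apply/andP; split; lra.
have [r r0|x ux] := @rnorm_cauchy_cvg _ _ u.
  have [|N hN] := expr_eventually_lt half01 (_ : 0 < c * r / 2).
    by rewrite divr_gt0// mulr_gt0.
  exists N => m n /hN um /hN un; rewrite -(ltr_pM2l c0).
  apply: (le_lt_trans (hc _)); rewrite shiftB.
  apply: (le_lt_trans (le_rnorm_distD _ y _)).
  rewrite [X in _ + X]rnormB; have := hu m; have := hu n; lra.
exists x; apply/eqP; rewrite -subr_eq0; apply/eqP/rnorm0_eq0.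
apply/eqP; rewrite eq_le rnorm_ge0 andbT; apply/ler_addgt0Pr => r r0.
rewrite add0r; have [M M0 hM] := bounded_operatorP.
have K0 : 0 < M + rnorm z by rewrite ltr_pwDl ?rnorm_ge0.
have [|N hN] := ux (r / 2 / (M + rnorm z)); first by rewrite !divr_gt0.
have [|N' hN'] := expr_eventually_lt half01 (_ : 0 < r / 2); first by rewrite divr_gt0.
pose n := maxn N N'.
apply: (le_trans (le_rnorm_distD _ (T (u n) - (z : R[i]) *: u n) _)).
rewrite -shiftB [leRHS](splitr r) lerD//; last first.
  by rewrite (le_trans (ltW (hu n)))// ltW// hN'// leq_maxr.
apply: (le_trans (le_rnormB _ _)); rewrite rnormZ.
apply: (le_trans (lerD (hM _) (lexx _))); rewrite -mulrDl mulrC.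
by rewrite -ler_pdivlMr// rnormB ltW// hN// leq_maxl.
Qed.

Lemma bounded_below_near (z0 : C) (c : R) : bounded_below T z0 c ->
  forall z, rnorm (z - z0) <= c / 2 -> bounded_below T z (c / 2).
Proof.
move=> hc z zz0 x; have := hc x.
have -> : T x - (z0 : R[i]) *: x =
    T x - (z : R[i]) *: x + ((z - z0 : C) : R[i]) *: x.
  by rewrite scalerBl addrA subrK.
move=> /le_trans/(_ (le_rnormD _ _)); rewrite rnormZ.
have := ler_wpM2r (rnorm_ge0 x) zz0; lra.
Qed.

(** Put [w h = f (z + h) - f z].  Subtracting the equations at [z + h] and [z]
shows that [T - z] sends [w h] to [h *: (G + f z)] up to [o(h)], where [G] is the
derivative of [g]; the lower bound first gives [w h = O(h)], then that
[G + f z] is in the range of [T - z], and finally that its preimage is the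
derivative of [f]. *)
Lemma bounded_below_derivable (U : set C) (c : R) (f g : C -> H) : 0 < c ->
  open U -> (forall z, U z -> bounded_below T z c) ->
  (forall z, U z -> T (f z) - (z : R[i]) *: f z = g z) ->
  (forall z, U z -> derivable g z 1) -> forall z, U z -> derivable f z 1.
Proof.
move=> c0 oU hc fg dg z Uz.
have [G hG] := (derivable_rnormP g z).1 (dg z Uz).
have [d0 d00 Ud0] := (nbhs_rnormP z U).1 (open_nbhs_nbhs (conj oU Uz)).
have Uh (h : C) : rnorm h < d0 -> U (z + h).
  by move=> hd; apply: Ud0; rewrite addrAC subrr add0r.
(* The Lipschitz constant of [f] at [z]. *)
pose K := (1 + rnorm G + rnorm (f z)) / c.
have K0 : 0 < K.
  by rewrite divr_gt0// ltr_pwDl ?addr_ge0 ?rnorm_ge0// ltr_pwDl ?rnorm_ge0.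
pose w (h : C) := f (z + h) - f z.
have [d1 d10 hd1] := hG 1 ltr01.
have wE (h : C) : rnorm h < d0 ->
    T (w h) - (z + h : R[i]) *: w h = g (z + h) - g z + (h : R[i]) *: f z.
  move=> hd; rewrite /w (shiftB (z + h)) fg; last exact: Uh.
  have -> : T (f z) - (z + h : R[i]) *: f z = g z - (h : R[i]) *: f z.
    by rewrite -fg// scalerDl opprD addrA.
  by rewrite opprD opprK addrA.
have wK (h : C) : rnorm h < d0 -> rnorm h < d1 -> rnorm (w h) <= K * rnorm h.
  move=> hd0 hd; rewrite /K mulrAC ler_pdivlMr// mulrC.
  apply: (le_trans (hc _ (Uh h hd0) (w h))); rewrite wE//.
  apply: (le_trans (le_rnormD _ _)); rewrite rnormZ.
  rewrite [leRHS]mulrDl [rnorm (f z) * _]mulrC lerD//.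
  apply: (le_trans (le_rnorm_dist _ ((h : R[i]) *: G))).
  by rewrite [leRHS]mulrDl [rnorm G * _]mulrC rnormZ lerD// hd1.
(* [T - z] sends [w h] to [h *: (G + f z)] up to the error term of [g] and the
   term [h *: w h], which is quadratic in [h]. *)
have wz (h : C) : rnorm h < d0 ->
    T (w h) - (z : R[i]) *: w h - (h : R[i]) *: (G + f z) =
    (g (z + h) - g z - (h : R[i]) *: G) + (h : R[i]) *: w h.
  move=> hd; have /eqP := wE h hd.
  rewrite scalerDl opprD addrA subr_eq => /eqP ->.
  by rewrite [LHS]addrAC scalerDr opprD [_ + _ *: f z + _]addrACA subrr addr0.
have key (r : R) : 0 < r -> exists2 d, 0 < d & forall h : C, rnorm h < d ->
    rnorm (T (w h) - (z : R[i]) *: w h - (h : R[i]) *: (G + f z)) <= r * rnorm h.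
  move=> r0; have [|d2 d20 hd2] := hG (r / 2); first by rewrite divr_gt0.
  exists (Num.min (Num.min d0 d1) (Num.min d2 (r / 2 / K))).
    by rewrite !lt_min d00 d10 d20 /= divr_gt0 // divr_gt0.
  move=> h; rewrite !lt_min -!andbA => /and4P[h0 h1 h2 hr].
  rewrite wz//; apply: (le_trans (le_rnormD _ _)).
  rewrite [in leRHS](splitr r) mulrDl lerD ?hd2// rnormZ mulrC ler_wpM2r ?rnorm_ge0//.
  apply: (le_trans (wK h h0 h1)).
  by rewrite mulrC -ler_pdivlMr// ltW.
have [r r0|D hD] := @bounded_below_closed_range z c (G + f z) c0 (hc z Uz).
  have [|d dd0 hd] := key (r / 2); first by rewrite divr_gt0.
  pose h : C := (d / 2)%:C%C.
  have nh : rnorm h = d / 2 by rewrite rnormr ger0_norm// divr_ge0// ltW.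
  have h0 : h != 0 by rewrite -rnorm_gt0 nh divr_gt0.
  exists ((h : R[i])^-1 *: w h).
  have -> : T ((h : R[i])^-1 *: w h) - (z : R[i]) *: ((h : R[i])^-1 *: w h) - (G + f z) =
     (h : R[i])^-1 *: (T (w h) - (z : R[i]) *: w h - (h : R[i]) *: (G + f z)).
    by rewrite linearZ/= !scalerBr !scalerA mulVf// scale1r mulrC.
  rewrite rnormZ rnormV mulrC ltr_pdivrMr ?rnorm_gt0//.
  apply: (le_lt_trans (hd h _)); rewrite ?nh.
    by rewrite ltr_pdivrMr// ltr_pMr// ltr1n.
  by rewrite ltr_pM2r ?divr_gt0// ltr_pdivrMr// ltr_pMr// ltr1n.
apply/derivable_rnormP; exists D => r r0.
have [|d dd0 hd] := key (c * r); first by rewrite mulr_gt0.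
exists d => // h hh; rewrite -(ler_pM2l c0) mulrA.
apply: (le_trans _ (hd h hh)); apply: (le_trans (hc z Uz _)).
have -> : (h : R[i]) *: (G + f z) =
    T ((h : R[i]) *: D) - (z : R[i]) *: ((h : R[i]) *: D).
  by rewrite -hD [in RHS]linearZ/= scalerBr !scalerA [(z : R[i]) * _]mulrC.
by rewrite shiftB.
Qed.

End Operator.
End BoundedBelow.

(** * Uniform convergence on compact sets *)

Section CompactConvergence.
Context {R : realType} {H : completeNormedModType R[i]}.
Local Notation C := R[i]^o.

Lemma entourage_rnormP (E : set (H * H)) :
  entourage E <-> exists2 r : R, 0 < r & forall x y, rnorm (y - x) < r -> E (x, y).
Proof.
rewrite -entourage_ballE; split=> [[e /= /gt0_complexE[r r0 ->] hE]|[r r0 hE]].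
  by exists r => // x y xy; apply: hE; rewrite /= -ball_normE /= normE ltcR rnormB.
exists r%:C%C; first by rewrite /= ltcR.
by move=> [x y]; rewrite /= -ball_normE /= normE ltcR rnormB; exact: hE.
Qed.

(** Finite unions of compact sets are compact, so uniform approximation on one
compact set at a time describes the neighbourhoods of this topology. *)
Lemma closure_compacts_inP (U : set C) (A : set (C -> H)) (g : C -> H) :
  closure (A : set {family compacts_in U, C -> H}) g <->
  forall K, compact K -> K `<=` U -> forall r : R, 0 < r ->
    exists2 f, A f & forall z, K z -> rnorm (f z - g z) < r.
Proof.
split=> [cl K cK KU r r0|hA].
  have entE : entourage [set xy : H * H | rnorm (xy.2 - xy.1) < r].
    by apply/entourage_rnormP; exists r.
  have [f [Af hf]] := cl _ (@fam_nbhs _ _ (compacts_in U) K _ g entE (conj cK KU)).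
  by exists f => // z Kz; exact: hf Kz.
pose B (Kr : set C * R) := [set f | A f /\ forall z, Kr.1 z -> rnorm (f z - g z) < Kr.2].
pose D := [set Kr : set C * R | compacts_in U Kr.1 /\ 0 < Kr.2].
have FF : Filter (filter_from D B).
  apply: filter_from_filter.
    by exists (set0, 1); split=> //; split; [exact: compact0|exact: sub0set].
  move=> [K r] [L s] [[/= cK KU] r0] [[/= cL LU] s0].
  exists (K `|` L, Num.min r s).
    split=> /=; last by rewrite lt_min r0.
    by split; [exact: compactU|rewrite subUset].
  move=> f [Af hf]; split; split=> //= z Kz.
    by have := hf z (or_introl Kz); rewrite lt_min => /andP[].
  by have := hf z (or_intror Kz); rewrite lt_min => /andP[].
have PF : ProperFilter (filter_from D B).
  apply: filter_from_proper => -[K r] [[/= cK KU] r0].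
  by have [f Af hf] := hA K cK KU r r0; exists f.
rewrite (closureEcvg (A : set {family compacts_in U, C -> H})).
exists (filter_from D B) => //; split; last first.
  by move=> X AX; exists (set0, 1); [|move=> f [Af _]; exact: AX];
    by split=> //; split; [exact: compact0|exact: sub0set].
apply/fam_cvgP => K [cK KU] X /uniform_nbhs[E [/entourage_rnormP[r r0 hE] EX]].
exists (K, r) => // f [Af hf]; apply: EX => z Kz; apply: hE; exact: hf.
Qed.

End CompactConvergence.

(** * Localization and rotation of Bishop's property *)

Section BishopLocal.
Context {R : realType} {H : completeNormedModType R[i]}.
Local Notation C := R[i]^o.
Implicit Types (U V : set C) (f g : C -> H).

(** Restriction to [U], in the encoding of analytic functions on [U] by functions
that vanish outside [U]. *)
Definition extend0 U f : C -> H := fun z => if `[< U z >] then f z else 0.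

Lemma extend0E U f z : U z -> extend0 U f z = f z.
Proof. by move=> Uz; rewrite /extend0 asboolT. Qed.

Lemma extend0_out U f z : ~ U z -> extend0 U f z = 0.
Proof. by move=> Uz; rewrite /extend0 asboolF. Qed.

Lemma extend0_analytic U f : open U -> (forall z, U z -> derivable f z 1) ->
  analytic_functions U (extend0 U f).
Proof.
move=> oU df; split=> [z Uz|z]; last exact: extend0_out.
by apply: (eq_on_open_derivable oU Uz _ (df z Uz)) => u Uu; rewrite extend0E.
Qed.

Lemma analytic_eq U f g : analytic_functions U f -> analytic_functions U g ->
  (forall z, U z -> f z = g z) -> f = g.
Proof.
move=> [_ f0] [_ g0] fg; apply/funext => z.
by have [Uz|nUz] := pselect (U z); [exact: fg|rewrite f0// g0].
Qed.

Lemma sub_analytic_extend0 U V f : open V -> V `<=` U -> analytic_functions U f ->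
  analytic_functions V (extend0 V f).
Proof. by move=> oV VU [df _]; apply: extend0_analytic => // z /VU; exact: df. Qed.

Section Operator.
Variable T : {linear H -> H}.

Definition beta_on U := injective_on T U /\ closed_range_on T U.

Lemma pointwise_shift_out f z : f z = 0 -> pointwise_shift T f z = 0.
Proof. by rewrite /pointwise_shift => ->; rewrite raddf0 scaler0 subrr. Qed.

Lemma injective_onP U : injective_on T U <->
  forall f g, analytic_functions U f -> analytic_functions U g ->
    (forall z, U z -> pointwise_shift T f z = pointwise_shift T g z) -> f = g.
Proof.
split=> [inj f g Af Ag fg|inj f g /set_mem Af /set_mem Ag fg].
  apply: inj; rewrite ?inE//; apply/funext => z.
  have [Uz|nUz] := pselect (U z); first exact: fg.
  by rewrite !pointwise_shift_out//; [apply Ag|apply Af].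
by apply: inj => // z _; rewrite fg.
Qed.

Lemma closed_range_onP U : closed_range_on T U <->
  forall g, analytic_functions U g ->
    (forall K, compact K -> K `<=` U -> forall r : R, 0 < r ->
       exists2 f, analytic_functions U f &
         forall z, K z -> rnorm (pointwise_shift T f z - g z) < r) ->
    exists2 f, analytic_functions U f &
      forall z, U z -> pointwise_shift T f z = g z.
Proof.
split=> cr.
  move=> g Ag gcl; have [|f Af <-] := cr g; last by exists f.
  split=> //; apply/closure_compacts_inP => K cK KU r r0.
  have [f Af hf] := gcl K cK KU r r0.
  by exists (pointwise_shift T f) => //; exists f.
move=> g [Ag /closure_compacts_inP gcl]; have [//|K cK KU r r0|f Af hf] := cr g.
  by have [_ [f Af <-] hf] := gcl K cK KU r r0; exists f.
exists f => //; apply/funext => z; have [Uz|nUz] := pselect (U z).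
  exact: hf.
rewrite pointwise_shift_out; last by apply Af.
by apply/esym; apply Ag.
Qed.

(** Points are compact, so an element of the closure of the range has, at each
point [z], a value in the closure of the range of [T - z], hence in that range;
the pointwise preimages form an analytic function. *)
Lemma bounded_below_beta_on U (c : R) : bounded_operator T -> 0 < c -> open U ->
  (forall z, U z -> bounded_below T z c) -> beta_on U.
Proof.
move=> bT c0 oU hc; split.
  apply/injective_onP => f g Af Ag fg; apply: (analytic_eq Af Ag) => z Uz.
  apply/eqP; rewrite -subr_eq0; apply/eqP/rnorm0_eq0/eqP.
  rewrite eq_le rnorm_ge0 andbT -(ler_pM2l c0) mulr0.
  have := hc z Uz (f z - g z); rewrite shiftB.
  by have := fg z Uz; rewrite /pointwise_shift => ->; rewrite subrr rnorm0.
apply/closed_range_onP => g [dg _] gcl.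
have ex z : exists x, U z -> T x - (z : R[i]) *: x = g z.
  have [Uz|] := pselect (U z); last by exists 0.
  have [r r0|x hx] := @bounded_below_closed_range _ _ T bT z c (g z) c0 (hc z Uz).
    have [||f _ hf] := gcl [set z] _ _ r r0.
    - exact: compact_set1.
    - by move=> _ ->.
    - by exists (f z); exact: hf.
  by exists x.
have [f hf] := choice ex.
exists (extend0 U f).
  apply: extend0_analytic => //; exact: (bounded_below_derivable bT c0 oU hc hf dg).
by move=> z Uz; rewrite /pointwise_shift extend0E// hf.
Qed.

(** Near each point, an element [g] of the closure of the range has a preimage,
which is unique on every smaller open set; these local preimages coincide on
overlaps and define a global one. *)
Lemma bishop_beta_local : (forall z, bishop_beta_at T z) -> bishop_beta T.
Proof.
move=> loc U oU.
have [V hV] := choice loc.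
pose W z := U `&` V z.
have oW z : open (W z) by apply: openI => //; have [[]] := hV z.
have Wz z : U z -> W z z by move=> Uz; split=> //; have [[]] := hV z.
have WU z : W z `<=` U by move=> u [].
have bW z (X : set C) : open X -> X `<=` W z -> beta_on X.
  by move=> oX XW; have [_] := hV z; apply=> // u /XW[].
split.
  apply/injective_onP => f g Af Ag fg; apply: (analytic_eq Af Ag) => z Uz.
  have [/injective_onP inj _] := bW z (W z) (oW z) (@subset_refl _ _).
  rewrite -(extend0E f (Wz z Uz)) -(extend0E g (Wz z Uz)).
  congr (_ z); apply: inj.
  - exact: (sub_analytic_extend0 (oW z) (@WU z) Af).
  - exact: (sub_analytic_extend0 (oW z) (@WU z) Ag).
  - move=> u Wu; rewrite /pointwise_shift !extend0E//; exact: fg (WU _ _ Wu).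
apply/closed_range_onP => g Ag gcl.
have ex z : exists f : C -> H, U z ->
    analytic_functions (W z) f /\ forall u, W z u -> pointwise_shift T f u = g u.
  have [Uz|] := pselect (U z); last by exists (cst 0).
  have [_ /closed_range_onP cr] := bW z (W z) (oW z) (@subset_refl _ _).
  have [||f Af hf] := cr (extend0 (W z) g).
  - exact: (sub_analytic_extend0 (oW z) (@WU z) Ag).
  - move=> K cK KW r r0.
    have [|f Af hf] := gcl K cK _ r r0; first by move=> u /KW/WU.
    exists (extend0 (W z) f); first exact: (sub_analytic_extend0 (oW z) (@WU z) Af).
    move=> u Ku; have Wu := KW _ Ku.
    by rewrite /pointwise_shift !extend0E//; exact: hf.
  - by exists f => _; split=> // u Wu; rewrite hf// extend0E.
have [f hf] := choice ex.
have same z u v : U z -> U u -> W z v -> W u v -> f z v = f u v.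
  move=> Uz Uu zv uv; pose X := W z `&` W u.
  have oX : open X by exact: openI.
  have [|/injective_onP inj _] := bW z X oX; first by move=> ? [].
  have Xv : X v by [].
  rewrite -(extend0E (f z) Xv) -(extend0E (f u) Xv); congr (_ v).
  have [Az hz] := hf z Uz; have [Au hu] := hf u Uu.
  apply: inj.
  - by apply: (sub_analytic_extend0 oX _ Az) => ? [].
  - by apply: (sub_analytic_extend0 oX _ Au) => ? [].
  - move=> t [zt ut]; rewrite /pointwise_shift !extend0E//.
    have := hz t zt; have := hu t ut; rewrite /pointwise_shift => -> ->.
    by [].
pose F : C -> H := fun z => f z z.
have FE z u : U z -> W z u -> f z u = F u.
  by move=> Uz zu; apply: same => //; [exact: WU zu|apply: Wz; exact: WU zu].
exists (extend0 U F).
  apply: extend0_analytic => // z Uz.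
  have [[df _] _] := hf z Uz.
  apply: (eq_on_open_derivable (oW z) (Wz z Uz) _ (df z (Wz z Uz))).
  by move=> u; exact: FE.
move=> z Uz; have [_ hz] := hf z Uz.
by rewrite /pointwise_shift extend0E//; have := hz z (Wz z Uz).
Qed.

End Operator.

Section Rotation.
Variables (T W W' : {linear H -> H}) (a : C).
Hypotheses (a1 : rnorm a = 1) (W1 : forall x, rnorm (W x) <= rnorm x)
  (W'1 : forall x, rnorm (W' x) <= rnorm x)
  (WK : cancel W W') (W'K : cancel W' W)
  (TW : forall x, T (W x) = (a : R[i]) *: W (T x)).

Lemma derivable_rotate (B : {linear H -> H}) (b : C) f z : rnorm b = 1 ->
  (forall x, rnorm (B x) <= rnorm x) -> derivable f (b * z) 1 ->
  derivable (fun u : C => B (f (b * u))) z 1.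
Proof.
move=> b1 B1 /derivable_rnormP[D hD]; apply/derivable_rnormP.
exists ((b : R[i]) *: B D) => r r0; have [d d0 hd] := hD r r0.
exists d => // h hh; rewrite scalerA -linearZ/= -!raddfB/= mulrDr.
apply: (le_trans (B1 _)); have -> : rnorm h = rnorm (b * h : C).
  by rewrite rnormM b1 mul1r.
by rewrite [(h : R[i]) * b]mulrC; apply: hd; rewrite rnormM b1 mul1r.
Qed.

Let a0 : a != 0. Proof. by rewrite -rnorm_gt0 a1. Qed.

Let aV1 : rnorm (a^-1 : C) = 1. Proof. by rewrite rnormV a1 invr1. Qed.

Let shiftW (z : C) x : T (W x) - ((a * z : C) : R[i]) *: W x =
  (a : R[i]) *: W (T x - (z : R[i]) *: x).
Proof. by rewrite TW raddfB/= scalerBr [W (_ *: _)]linearZ/= scalerA. Qed.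

Lemma mulr_open_preimage (b : C) U : rnorm b = 1 -> open U ->
  open [set z : C | U (b * z)].
Proof.
move=> b1 oU; rewrite openE => z /= Uz.
have [r r0 hr] := (nbhs_rnormP _ _).1 (open_nbhs_nbhs (conj oU Uz)).
apply/nbhs_rnormP; exists r => // u uz; apply: hr.
by rewrite -mulrBr rnormM b1 mul1r.
Qed.

(** The map [Phi] sending [f] to [fun z => W' (f (a * z))] carries analytic
functions near [a * z0] to analytic functions near [z0], and composing it with the
action of [T] amounts, up to the factor [a], to acting by [T] afterwards. *)
Lemma bishop_beta_at_rotate z0 : bishop_beta_at T z0 -> bishop_beta_at T (a * z0).
Proof.
move=> [V [[oV Vz0] hV]]; exists [set u : C | V (a^-1 * u)]; split.
  by split; [exact: mulr_open_preimage|rewrite /= mulrA mulVf// mul1r].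
move=> U' oU' U'V; pose U := [set z : C | U' (a * z)].
have oU : open U by exact: mulr_open_preimage.
have UV : U `<=` V by move=> z /U'V /=; rewrite mulrA mulVf// mul1r.
have aU u : U' u -> U (a^-1 * u) by rewrite /U /= mulrA divff// mul1r.
have [/injective_onP inj /closed_range_onP cr] := hV U oU UV.
pose Phi f : C -> H := fun z => W' (f (a * z)).
have PhiA f : analytic_functions U' f -> analytic_functions U (Phi f).
  move=> [df f0]; split=> z Uz; first by apply: derivable_rotate => //; exact: df.
  by rewrite /Phi f0// raddf0.
have PhiT f z : Phi (pointwise_shift T f) z = (a : R[i]) *: pointwise_shift T (Phi f) z.
  have := shiftW z (W' (f (a * z))); rewrite W'K /Phi /pointwise_shift => ->.
  by rewrite linearZ/= WK.
split.
  apply/injective_onP => f g Af Ag fg.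
  have PhiE : Phi f = Phi g.
    apply: inj; [exact: PhiA|exact: PhiA|move=> z Uz].
    apply: (scalerI a0); rewrite -!PhiT /Phi; congr (W' _); exact: fg.
  apply: (analytic_eq Af Ag) => u Uu.
  have := congr1 (fun F : C -> H => W (F (a^-1 * u))) PhiE.
  by rewrite /Phi !W'K mulrA divff// mul1r.
apply/closed_range_onP => g Ag gcl.
have [||h Ah hT] := cr (fun z => (a^-1 : R[i]) *: Phi g z).
- have [dg g0] := PhiA g Ag; split=> z Uz; last by rewrite g0// scaler0.
  exact: (derivableZ (dg z Uz)).
- move=> K cK KU r r0.
  have [||f Af hf] := gcl ((fun z : C => a * z) @` K) _ _ r r0.
  + apply: continuous_compact cK; apply: continuous_subspaceT => z.
    exact: mulrl_continuous.
  + by move=> _ [z /KU Uz <-].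
  exists (Phi f); first exact: PhiA.
  move=> z Kz; have -> : pointwise_shift T (Phi f) z =
      (a^-1 : R[i]) *: Phi (pointwise_shift T f) z.
    by rewrite PhiT scalerA mulVf// scale1r.
  rewrite -scalerBr rnormZ aV1 mul1r -raddfB/=.
  by apply: (le_lt_trans (W'1 _)); apply: hf; exists z.
exists (fun u => W (h (a^-1 * u))).
  have [dh h0] := Ah; split=> u Uu.
    by apply: derivable_rotate => //; apply: dh; exact: aU.
  by rewrite h0 ?raddf0//= /U /= mulrA divff// mul1r.
move=> u Uu; rewrite /pointwise_shift.
have -> : (u : R[i]) = a * (a^-1 * u) by rewrite mulrA divff// mul1r.
rewrite [a^-1 * (a * _)]mulrA mulVf// mul1r shiftW.
have := hT _ (aU u Uu); rewrite /pointwise_shift => ->.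
by rewrite linearZ/= scalerA divff// scale1r /Phi W'K.
Qed.

End Rotation.
End BishopLocal.

(** * Orthonormal bases *)

Section OrthonormalBasis.
Context {R : realType} {H : completeNormedModType R[i]}.
Local Notation C := R[i]^o.
Variables (dot : {dot H for conjugation R}) (hilbertH : is_hilbert dot).

Lemma dotDl x y z : dot (x + y) z = dot x z + dot y z.
Proof. exact: linearDl. Qed.

Lemma dotZl a x z : dot (a *: x) z = a * dot x z.
Proof. exact: linearZl_LR. Qed.

Lemma dot0l z : dot 0 z = 0.
Proof. exact: linear0l. Qed.

Lemma pythagoras x y : dot x y = 0 -> rnorm (x + y) ^+ 2 = rnorm x ^+ 2 + rnorm y ^+ 2.
Proof.
move=> xy; have sqrE u : (rnorm u ^+ 2)%:C%C = dot u u.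
  by rewrite -hilbertH normE rmorphXn.
have : (rnorm (x + y) ^+ 2)%:C%C = (rnorm x ^+ 2)%:C%C + (rnorm y ^+ 2)%:C%C.
  by rewrite !sqrE dnormD xy rmorph0 addr0 addr0.
by rewrite -rmorphD => /complexI.
Qed.

Lemma dot_orthonormal_sum (f : nat -> H) (a : nat -> R[i]) n k :
  (forall i j, dot (f i) (f j) = (i == j)%:R) ->
  dot (\sum_(i < n) a i *: f i) (f k) = if (k < n)%N then a k else 0.
Proof.
move=> ff; elim: n => [|n ih]; first by rewrite big_ord0 dot0l.
rewrite big_ord_recr/= dotDl ih dotZl ff ltnS [in RHS]leq_eqVlt [n == k]eq_sym.
have [->|_] := eqVneq k n; first by rewrite ltnn add0r mulr1.
by rewrite mulr0 addr0.
Qed.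

Lemma rnorm_orthonormal_sum (f : nat -> H) (a : nat -> R[i]) n :
  (forall i j, dot (f i) (f j) = (i == j)%:R) ->
  rnorm (\sum_(i < n) a i *: f i) ^+ 2 = \sum_(i < n) rnorm (a i : C) ^+ 2.
Proof.
move=> ff; elim: n => [|n ih]; first by rewrite !big_ord0 rnorm0 expr0n.
rewrite !big_ord_recr/= pythagoras ?ih; last first.
  by rewrite linearZr_LR/= dot_orthonormal_sum// ltnn mulr0.
have f1 : rnorm (f n) ^+ 2 = 1.
  have := hilbertH (f n); rewrite ff eqxx normE -rmorphXn/=.
  by move=> h; have := @complexI R (rnorm (f n) ^+ 2) 1; apply; rewrite h rmorph1.
by rewrite rnormZ exprMn f1 mulr1.
Qed.

Variables (e : nat -> H) (basis_e : orthonormal_basis dot e).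

Let ee i j : dot (e i) (e j) = (i == j)%:R. Proof. exact: basis_e.1. Qed.

Lemma rnorm_basis k : rnorm (e k) = 1.
Proof.
have := @rnorm_orthonormal_sum (fun i => e (i + k)) (fun=> 1) 1.
rewrite !big_ord1 scale1r rnorm1 expr1n => /(_ _)/eqP; rewrite sqrp_eq1 ?rnorm_ge0//.
by move=> h; apply/eqP/h => i j; rewrite ee eqn_add2r.
Qed.

Definition fourier k (x : H) : C := dot x (e k).

Lemma fourierD k x y : fourier k (x + y) = fourier k x + fourier k y.
Proof. by rewrite /fourier dotDl. Qed.

Lemma fourierZ k (a : R[i]) x : fourier k (a *: x) = a * fourier k x.
Proof. by rewrite /fourier dotZl. Qed.

Lemma fourierB k x y : fourier k (x - y) = fourier k x - fourier k y.
Proof. by rewrite fourierD -scaleN1r fourierZ mulN1r. Qed.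

Lemma fourier0 k : fourier k 0 = 0.
Proof. by rewrite -(subrr (0 : H)) fourierB subrr. Qed.

Lemma fourier_sum k (I : Type) (s : seq I) (P : pred I) (F : I -> H) :
  fourier k (\sum_(i <- s | P i) F i) = \sum_(i <- s | P i) fourier k (F i).
Proof. exact: (big_morph (fourier k) (fourierD k) (fourier0 k)). Qed.

Lemma fourier_basis k i : fourier k (e i) = (i == k)%:R.
Proof. exact: ee. Qed.

(** Removing the component of [x] along [e k] leaves an orthogonal remainder. *)
Lemma fourier_le k x : rnorm (fourier k x) <= rnorm x.
Proof.
have xE : x = (x - (fourier k x : R[i]) *: e k) + (fourier k x : R[i]) *: e k by rewrite subrK.
have orth : dot (x - (fourier k x : R[i]) *: e k) ((fourier k x : R[i]) *: e k) = 0.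
  rewrite linearZr_LR/= (_ : dot _ _ = fourier k (x - (fourier k x : R[i]) *: e k))//.
  by rewrite fourierB fourierZ fourier_basis eqxx mulr1 subrr mulr0.
have := pythagoras orth; rewrite -xE rnormZ rnorm_basis mulr1 => h.
by rewrite -ler_sqr ?nnegrE ?rnorm_ge0// h lerDr sqr_ge0.
Qed.

Definition lincomb n (a : nat -> R[i]) : H := \sum_(i < n) a i *: e i.

Lemma lincomb_dense x (r : R) : 0 < r -> exists n a, rnorm (x - lincomb n a) < r.
Proof.
move=> r0; have : closure [set x | exists n (a : nat -> R[i]), x = \sum_(i < n) a i *: e i] x.
  by rewrite basis_e.2.
by move=> /closure_rnormP/(_ r r0)[_ [n [a ->]]]; exists n, a; rewrite rnormB.
Qed.

(** The device that extends inequalities from finite combinations of basis vectors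
to the whole space. *)
Lemma lipschitz_le0 (F : H -> R) (L : R) :
  (forall x y, F x <= F y + L * rnorm (x - y)) ->
  (forall n a, F (lincomb n a) <= 0) -> forall x, F x <= 0.
Proof.
move=> lipF F0 x; apply/ler_addgt0Pr => r r0; rewrite add0r.
have L0 : 0 < `|L| + 1 by rewrite ltr_wpDl.
have [|n [a xa]] := @lincomb_dense x (r / (`|L| + 1)); first by rewrite divr_gt0.
apply: (le_trans (lipF x (lincomb n a))).
rewrite -[leRHS]add0r lerD//; move/ltW: xa; rewrite ler_pdivlMr// mulrC.
apply: le_trans; rewrite ler_wpM2r ?rnorm_ge0//.
by rewrite (le_trans (ler_norm L))// lerDl.
Qed.

Lemma bounded_eq_on_basis (A B : {linear H -> H}) :
  bounded_operator A -> bounded_operator B -> (forall k, A (e k) = B (e k)) ->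
  forall x, A x = B x.
Proof.
move=> /bounded_operatorP[M M0 hM] /bounded_operatorP[N N0 hN] AB x.
apply/eqP; rewrite -subr_eq0; apply/eqP/rnorm0_eq0/eqP.
rewrite eq_le rnorm_ge0 andbT.
move: x; apply: (@lipschitz_le0 _ (M + N)) => [x y|n a].
  apply: (le_trans (le_rnorm_dist _ (A y - B y))); rewrite addrC lerD2l.
  have -> : A x - B x - (A y - B y) = A (x - y) - B (x - y).
    by rewrite [A (_ - _)]raddfB [B (_ - _)]raddfB/= !opprD !opprK addrACA.
  apply: (le_trans (le_rnormB _ _)); rewrite mulrDl lerD//.
suff -> : A (lincomb n a) = B (lincomb n a) by rewrite subrr rnorm0.
by rewrite /lincomb !linear_sum; apply: eq_bigr => i _; rewrite !linearZ/= AB.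
Qed.

End OrthonormalBasis.

(** * Diagonal operators *)

Lemma linear_map_of (K : pzRingType) (V W : lmodType K) (B : V -> W) : linear B ->
  exists L : {linear V -> W}, L =1 B.
Proof.
move=> linB; pose mB := GRing.isLinear.Build K V W *:%R B linB.
by exists (HB.pack_for {linear V -> W} B mB).
Qed.

Section DiagonalOperator.
Context {R : realType} {H : completeNormedModType R[i]}.
Local Notation C := R[i]^o.
Variables (dot : {dot H for conjugation R}) (hilbertH : is_hilbert dot).
Variables (e : nat -> H) (basis_e : orthonormal_basis dot e).
Local Notation coef := (fourier dot e).

Let ee i j : dot (e i) (e j) = (i == j)%:R. Proof. exact: basis_e.1. Qed.

Lemma fourier_total x : (forall k, coef k x = 0) -> x = 0.
Proof.
move=> x0; apply/rnorm0_eq0/eqP; rewrite eq_le rnorm_ge0 andbT.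
apply/ler_addgt0Pr => r r0; rewrite add0r.
have [n [a xa]] := lincomb_dense basis_e x r0.
have orth : dot (- lincomb e n a) x = 0.
  rewrite -scaleN1r dotZl /lincomb hermC/= expr0 mul1r.
  suff -> : dot x (\sum_(i < n) a i *: e i) = 0 by rewrite rmorph0 mulr0.
  rewrite linear_sum/= big1// => i _; rewrite linearZr_LR/=.
  by have := x0 i; rewrite /fourier => ->; rewrite mulr0.
have := pythagoras hilbertH orth; rewrite addrC => h.
apply: le_trans (ltW xa); rewrite -ler_sqr ?nnegrE ?rnorm_ge0// h.
by rewrite lerDr sqr_ge0.
Qed.

Lemma bessel x n : \sum_(i < n) rnorm (coef i x) ^+ 2 <= rnorm x ^+ 2.
Proof.
pose p := \sum_(i < n) (coef i x : R[i]) *: e i.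
have pE k : (k < n)%N -> coef k p = coef k x.
  by move=> kn; rewrite /fourier /p (dot_orthonormal_sum (fun i => coef i x : R[i]))// kn.
have orth : dot (x - p) p = 0.
  rewrite {2}/p linear_sum/= big1// => i _; rewrite linearZr_LR/=.
  rewrite (_ : dot _ _ = coef i (x - p))// fourierB pE// subrr mulr0//.
have := pythagoras hilbertH orth; rewrite subrK => ->.
by rewrite {2}/p (rnorm_orthonormal_sum hilbertH (fun i => coef i x : R[i]))// lerDr sqr_ge0.
Qed.

(** By Bessel's inequality the partial sums of
[\sum_k a k * coef k x *: e k] are Cauchy.  Linearity of the limit is read off its
coordinates. *)
Lemma diagonal_operator (a : nat -> C) : (forall k, rnorm (a k) <= 1) ->
  exists W : {linear H -> H}, (forall x, rnorm (W x) <= rnorm x) /\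
    forall k, W (e k) = (a k : R[i]) *: e k.
Proof.
move=> a1.
pose p x n : H := \sum_(i < n) (a i * coef i x : R[i]) *: e i.
pose B x n := \sum_(i < n) rnorm (coef i x) ^+ 2.
have pp x n m : (n <= m)%N -> rnorm (p x m - p x n) ^+ 2 <= B x m - B x n.
  move=> nm; pose c i : R[i] := if (n <= i)%N then a i * coef i x else 0.
  have sub (V : zmodType) (F : nat -> V) : \sum_(i < m) (if (n <= i)%N then F i else 0)
      = \sum_(i < m) F i - \sum_(i < n) F i.
    rewrite -(big_mkord predT F) -(big_mkord predT F).
    rewrite -(big_mkord predT (fun i => if (n <= i)%N then F i else 0)).
    rewrite (big_cat_nat (leq0n n) nm)/= (big_cat_nat (leq0n n) nm)/=.
    rewrite big_nat big1 => [|i /andP[_]]; last by rewrite ltnNge => /negbTE ->.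
    rewrite add0r addrAC subrr add0r big_nat [RHS]big_nat.
    by apply: eq_bigr => i /andP[-> _].
  have -> : p x m - p x n = \sum_(i < m) c i *: e i.
    rewrite /p -(sub _ (fun i => (a i * coef i x : R[i]) *: e i)).
    by apply: eq_bigr => i _; rewrite /c; case: ifP => //; rewrite scale0r.
  rewrite (rnorm_orthonormal_sum hilbertH)// /B.
  rewrite -(sub _ (fun i => rnorm (coef i x) ^+ 2)).
  apply: ler_sum => i _; rewrite /c; case: ifP => _; last by rewrite rnorm0 expr0n.
  by rewrite rnormM exprMn ler_piMl ?sqr_ge0// expr_le1 ?rnorm_ge0.
have Bmono x n m : (n <= m)%N -> B x n <= B x m.
  by move=> nm; rewrite -subr_ge0 (le_trans _ (pp x n m nm))// sqr_ge0.
have pcvg x : exists l, forall r : R, 0 < r -> exists N, forall n, (N <= n)%N ->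
    rnorm (p x n - l) < r.
  apply: rnorm_cauchy_cvg => r r0.
  have supB : has_sup (range (B x)).
    split; first by exists (B x 0%N), 0%N.
    by exists (rnorm x ^+ 2) => _ [n _ <-]; exact: bessel.
  have [_ [N _ <-] hN] := sup_adherent (exprn_gt0 2 r0) supB.
  have wl n m : (N <= n)%N -> (n <= m)%N -> rnorm (p x m - p x n) < r.
    move=> Nn nm; rewrite -ltr_sqr ?nnegrE ?rnorm_ge0 ?(ltW r0)//.
    apply: (le_lt_trans (pp x n m nm)).
    have := Bmono x _ _ Nn; have : B x m <= sup (range (B x)).
      by apply: sup_upper_bound => //; exists m.
    by move=> h1 h2; rewrite ltrBlDr -ltrBlDl; apply: le_lt_trans (lt_le_trans hN h2);
       rewrite lerD2r.
  exists N => m n Nm Nn; have [mn|/ltnW nm] := leqP m n; last exact: wl.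
  by rewrite rnormB; exact: wl.
have [W hW] := choice pcvg.
have Wfourier k x : coef k (W x) = a k * coef k x.
  apply/eqP; rewrite -subr_eq0; apply/eqP/rnorm0_eq0/eqP.
  rewrite eq_le rnorm_ge0 andbT; apply/ler_addgt0Pr => r r0; rewrite add0r.
  have [N hN] := hW x r r0; pose n := maxn N k.+1.
  have <- : coef k (p x n) = a k * coef k x.
    by rewrite /fourier /p (dot_orthonormal_sum (fun i => a i * coef i x : R[i]))// leq_maxr.
  rewrite -fourierB; apply: (le_trans (fourier_le hilbertH basis_e _ _)).
  by rewrite rnormB ltW// hN// leq_maxl.
have linW : linear W.
  move=> b x y; apply/eqP; rewrite -subr_eq0; apply/eqP/fourier_total => k.
  rewrite fourierB !fourierD !fourierZ !Wfourier fourierD fourierZ.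
  by rewrite mulrDr mulrCA subrr.
have [L LW] := linear_map_of linW.
exists L; split=> [x|k].
  rewrite LW; apply/ler_addgt0Pr => r r0; have [N hN] := hW x r r0.
  apply: (le_trans (le_rnorm_dist _ (p x N))); rewrite addrC lerD//; last first.
    by rewrite rnormB ltW// hN.
  have := pp x 0%N N (leq0n N); rewrite /p /B !big_ord0 !subr0 => h.
  rewrite -ler_sqr ?nnegrE ?rnorm_ge0//; apply: (le_trans h); exact: bessel.
rewrite LW; apply/eqP; rewrite -subr_eq0; apply/eqP/fourier_total => i.
rewrite fourierB fourierZ Wfourier (fourier_basis basis_e).
by have [->|_] := eqVneq k i; rewrite ?subrr// !mulr0 subrr.
Qed.

End DiagonalOperator.

(** * Powers of a weighted shift *)

Section Iterates.
Context {R : realType} {H : completeNormedModType R[i]}.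
Local Notation C := R[i]^o.
Variables (T : {linear H -> H}) (bT : bounded_operator T).

Lemma iterB n x y : iter n T (x - y) = iter n T x - iter n T y.
Proof. by elim: n => //= n ->; rewrite [T (_ - _)]raddfB. Qed.

Lemma iter_bounded n : exists2 M : R, 0 < M &
  forall x, rnorm (iter n T x) <= M * rnorm x.
Proof.
have [M M0 hM] := bounded_operatorP bT.
exists (M ^+ n); first by rewrite exprn_gt0.
elim: n => [|n ih] x; first by rewrite expr0 mul1r.
rewrite iterS; apply: (le_trans (hM _)).
by rewrite exprS -mulrA ler_wpM2l// ltW.
Qed.

(** [T^n - z^n] is a bounded operator composed with [T - z]. *)
Lemma iter_sub_expr_le n (z : C) : exists2 K : R, 0 < K &
  forall x, rnorm (iter n T x - (z ^+ n : R[i]) *: x) <=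
            K * rnorm (T x - (z : R[i]) *: x).
Proof.
have [M M0 hM] := bounded_operatorP bT.
elim: n => [|n [K K0 hK]].
  by exists 1 => // x; rewrite /= scale1r subrr rnorm0 mul1r rnorm_ge0.
exists (M * K + rnorm z ^+ n); first by rewrite ltr_wpDr ?exprn_ge0 ?rnorm_ge0 ?mulr_gt0.
move=> x; have -> : iter n.+1 T x - (z ^+ n.+1 : R[i]) *: x =
    T (iter n T x - (z ^+ n : R[i]) *: x) + (z ^+ n : R[i]) *: (T x - (z : R[i]) *: x).
  rewrite iterS [T (_ - _)]raddfB/= [T (_ *: _)]linearZ/= scalerBr scalerA -exprSr.
  by rewrite addrA subrK.
apply: (le_trans (le_rnormD _ _)); rewrite mulrDl lerD//.
  by apply: (le_trans (hM _)); rewrite -mulrA ler_wpM2l// ltW.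
by rewrite rnormZ rnormX.
Qed.

Lemma bounded_below_of_iter_le n (q : R) (z : C) :
  (forall x, rnorm (iter n T x) <= q * rnorm x) -> q < rnorm z ^+ n ->
  exists2 c : R, 0 < c & bounded_below T z c.
Proof.
move=> hq qz; have [K K0 hK] := iter_sub_expr_le n z.
exists ((rnorm z ^+ n - q) / K); first by rewrite divr_gt0// subr_gt0.
move=> x; rewrite mulrAC ler_pdivrMr// [leRHS]mulrC; apply: le_trans (hK x).
have := le_rnorm_dist ((z ^+ n : R[i]) *: x) (iter n T x).
by rewrite rnormB rnormZ rnormX; have := hq x; lra.
Qed.

Lemma bounded_below_of_iter_ge n (q : R) (z : C) :
  (forall x, q * rnorm x <= rnorm (iter n T x)) -> rnorm z ^+ n < q ->
  exists2 c : R, 0 < c & bounded_below T z c.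
Proof.
move=> hq qz; have [K K0 hK] := iter_sub_expr_le n z.
exists ((q - rnorm z ^+ n) / K); first by rewrite divr_gt0// subr_gt0.
move=> x; rewrite mulrAC ler_pdivrMr// [leRHS]mulrC; apply: le_trans (hK x).
have := le_rnorm_dist (iter n T x) ((z ^+ n : R[i]) *: x).
by rewrite rnormZ rnormX; have := hq x; lra.
Qed.

End Iterates.

Section WeightedShift.
Context {R : realType} {H : completeNormedModType R[i]}.
Local Notation C := R[i]^o.
Variables (dot : {dot H for conjugation R}) (hilbertH : is_hilbert dot).
Variables (e : nat -> H) (basis_e : orthonormal_basis dot e).
Variables (w : nat -> R) (w_gt0 : forall n, 0 < w n).
Variables (S : {linear H -> H}) (shiftS : weighted_shift e w S).
Local Notation coef := (fourier dot e).

Let bS : bounded_operator S := shiftS.1.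

Let ee i j : dot (e i) (e j) = (i == j)%:R. Proof. exact: basis_e.1. Qed.

Let Se k : S (e k) = (w k)%:C%C *: e k.+1. Proof. exact: shiftS.2. Qed.

Definition weight_prod n : R := \prod_(i < n) w i.
Local Notation beta := weight_prod.

Lemma weight_prod_gt0 n : 0 < beta n.
Proof. by apply: prodr_gt0. Qed.

Lemma weight_prodS n : beta n.+1 = beta n * w n.
Proof. exact: big_ord_recr. Qed.

Lemma iter_shift_lincomb n m (a : nat -> R[i]) :
  iter n S (lincomb e m a) =
  \sum_(i < m) (a i * (beta (i + n) / beta i)%:C%C) *: e (i + n)%N.
Proof.
elim: n => [|n ih].
  by apply: eq_bigr => i _; rewrite addn0 divff ?gt_eqF ?weight_prod_gt0// mulr1.
rewrite iterS ih linear_sum; apply: eq_bigr => i _.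
rewrite linearZ/= Se scalerA addnS weight_prodS [_ * w _ / _]mulrAC [in RHS]rmorphM/=.
by rewrite [in RHS]mulrA.
Qed.

Lemma rnorm_iter_shift_lincomb n m (a : nat -> R[i]) :
  rnorm (iter n S (lincomb e m a)) ^+ 2 =
  \sum_(i < m) rnorm (a i : C) ^+ 2 * (beta (i + n) / beta i) ^+ 2.
Proof.
rewrite iter_shift_lincomb.
rewrite (rnorm_orthonormal_sum hilbertH
  (fun i => a i * (beta (i + n) / beta i)%:C%C : R[i]) _ (f := fun i => e (i + n)%N)).
  by apply: eq_bigr => i _; rewrite rnormM rnormr exprMn real_normK// num_real.
by move=> i j; rewrite ee eqn_add2r.
Qed.

Lemma rnorm_iter_shift_basis n k : rnorm (iter n S (e k)) = beta (k + n) / beta k.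
Proof.
have -> : iter n S (e k) = (beta (k + n) / beta k)%:C%C *: e (k + n)%N.
  elim: n => [|n ih].
    by rewrite addn0 divff ?gt_eqF ?weight_prod_gt0// scale1r.
  rewrite iterS ih linearZ/= Se scalerA addnS weight_prodS -rmorphM/=.
  by rewrite mulrAC.
rewrite rnormZ rnormr (rnorm_basis hilbertH basis_e) mulr1 ger0_norm//.
by rewrite divr_ge0// ltW// weight_prod_gt0.
Qed.

(** [S^n] sends an orthonormal basis to an orthogonal family, so its norm is the
supremum of the norms of the vectors [iter n S (e k)]. *)
Lemma iter_shift_le n (q : R) : 0 <= q ->
  (forall k, beta (k + n) <= q * beta k) ->
  forall x, rnorm (iter n S x) <= q * rnorm x.
Proof.
move=> q0 hq x; rewrite -subr_le0; have [M M0 hM] := iter_bounded bS n.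
move: x; apply: (@lipschitz_le0 _ _ _ _ basis_e _ (M + q)) => [x y|m a].
  have h1 := le_rnorm_dist (iter n S x) (iter n S y).
  have h2 := le_rnorm_dist y x; rewrite -iterB in h1.
  have h3 := hM (x - y); rewrite (rnormB y) in h2.
  have := ler_wpM2l q0 h2; lra.
rewrite subr_le0 -ler_sqr ?nnegrE ?mulr_ge0 ?rnorm_ge0//.
rewrite rnorm_iter_shift_lincomb exprMn (rnorm_orthonormal_sum hilbertH)// mulr_sumr.
apply: ler_sum => i _; rewrite mulrC ler_wpM2r ?sqr_ge0//.
have b0 := weight_prod_gt0 i; have b1 := weight_prod_gt0 (i + n).
rewrite ler_sqr ?nnegrE ?divr_ge0 ?(ltW b0) ?(ltW b1)//.
by rewrite ler_pdivrMr.
Qed.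

Lemma iter_shift_ge n (q : R) : 0 <= q ->
  (forall k, q * beta k <= beta (k + n)) ->
  forall x, q * rnorm x <= rnorm (iter n S x).
Proof.
move=> q0 hq x; rewrite -subr_le0; have [M M0 hM] := iter_bounded bS n.
move: x; apply: (@lipschitz_le0 _ _ _ _ basis_e _ (M + q)) => [x y|m a].
  have h1 := le_rnorm_dist (iter n S y) (iter n S x).
  have h2 := le_rnorm_dist x y; rewrite -iterB in h1.
  have h3 := hM (y - x); rewrite (rnormB y) in h3.
  have := ler_wpM2l q0 h2; lra.
rewrite subr_le0 -ler_sqr ?nnegrE ?mulr_ge0 ?rnorm_ge0//.
rewrite rnorm_iter_shift_lincomb exprMn (rnorm_orthonormal_sum hilbertH)// mulr_sumr.
apply: ler_sum => i _; rewrite [leRHS]mulrC ler_wpM2r ?sqr_ge0//.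
have b0 := weight_prod_gt0 i; have b1 := weight_prod_gt0 (i + n).
rewrite ler_sqr ?nnegrE ?divr_ge0 ?(ltW b0) ?(ltW b1)//.
by rewrite ler_pdivlMr.
Qed.

Lemma fourier_shift0 x : coef 0 (S x) = 0.
Proof.
apply/rnorm0_eq0/eqP; rewrite eq_le rnorm_ge0 andbT.
have [M M0 hM] := bounded_operatorP bS.
move: x; apply: (@lipschitz_le0 _ _ _ _ basis_e _ M) => [x y|m a].
  apply: (le_trans (le_rnorm_dist _ (coef 0 (S y)))); rewrite addrC lerD2l.
  rewrite -fourierB -[S x - S y]raddfB/=.
  by apply: (le_trans (fourier_le hilbertH basis_e _ _)).
rewrite /lincomb linear_sum fourier_sum big1 ?rnorm0// => i _.
by rewrite linearZ/= fourierZ Se fourierZ (fourier_basis basis_e) !mulr0.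
Qed.

Lemma fourier_shiftS k x : coef k.+1 (S x) = (w k)%:C%C * coef k x.
Proof.
apply/eqP; rewrite -subr_eq0; apply/eqP/rnorm0_eq0/eqP; rewrite eq_le rnorm_ge0 andbT.
have [M M0 hM] := bounded_operatorP bS.
move: x; apply: (@lipschitz_le0 _ _ _ _ basis_e _ (M + w k)) => [x y|m a].
  apply: (le_trans (le_rnorm_dist _ (coef k.+1 (S y) - (w k)%:C%C * coef k y))).
  rewrite addrC lerD2l.
  have -> : coef k.+1 (S x) - (w k)%:C%C * coef k x -
      (coef k.+1 (S y) - (w k)%:C%C * coef k y) =
      coef k.+1 (S (x - y)) - (w k)%:C%C * coef k (x - y).
    by rewrite [S (_ - _)]raddfB/= !fourierB mulrBr !opprD !opprK addrACA.
  apply: (le_trans (le_rnormB _ _)); rewrite mulrDl lerD//.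
    by apply: (le_trans (fourier_le hilbertH basis_e _ _)).
  rewrite rnormM rnormr gtr0_norm// ler_wpM2l ?(ltW (w_gt0 k))//.
  exact: (fourier_le hilbertH basis_e).
suff -> : coef k.+1 (S (lincomb e m a)) = (w k)%:C%C * coef k (lincomb e m a).
  by rewrite subrr rnorm0.
rewrite /lincomb linear_sum !fourier_sum mulr_sumr; apply: eq_bigr => i _.
rewrite linearZ/= !fourierZ Se fourierZ !(fourier_basis basis_e) eqSS.
have [->|_] := eqVneq (i : nat) k; last by rewrite !mulr0.
by rewrite !mulr1 mulrC.
Qed.

End WeightedShift.

(** * The spectral radius and the lower radius of a weighted shift *)

Lemma ratio_expr_lt {R : realType} (s t K : R) : 0 <= s -> s < t -> 0 < K ->
  exists N, forall n, (N <= n)%N -> s ^+ n < K * t ^+ n.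
Proof.
move=> s0 st K0; have t0 : 0 < t := le_lt_trans s0 st.
have [||N hN] := @expr_eventually_lt R (s / t) K.
- by rewrite divr_ge0 ?(ltW t0)//= ltr_pdivrMr// mul1r.
- by [].
exists N => n /hN; rewrite expr_div_n ltr_pdivrMr//; exact: exprn_gt0.
Qed.

Section Spectrum.
Context {R : realType} {H : completeNormedModType R[i]}.
Local Notation C := R[i]^o.
Variables (T : {linear H -> H}) (bT : bounded_operator T).

Lemma bounded_below_onto_notin_spectrum (z : C) (c : R) : 0 < c ->
  bounded_below T z c -> (forall y, exists x, T x - (z : R[i]) *: x = y) ->
  ~ spectrum T z.
Proof.
move=> c0 hc onto; have [B BK] := choice onto.
have inj x y : T x - (z : R[i]) *: x = T y - (z : R[i]) *: y -> x = y.
  move=> xy; apply/eqP; rewrite -subr_eq0; apply/eqP/rnorm0_eq0/eqP.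
  rewrite eq_le rnorm_ge0 andbT -(ler_pM2l c0) mulr0.
  by apply: (le_trans (hc _)); rewrite shiftB xy subrr rnorm0.
have linB : linear B.
  move=> a x y; apply: inj; rewrite BK [T (_ + _)]raddfD/= [T (_ *: _)]linearZ/=.
  rewrite [(z : R[i]) *: (_ + _)]scalerDr opprD addrACA BK; congr (_ + _).
  by rewrite scalerA mulrC -scalerA -scalerBr BK.
have [L LB] := linear_map_of linB.
apply; exists L; split=> [|x|x]; rewrite ?LB ?BK//; last by apply: inj; rewrite BK.
exists c^-1 => x; rewrite LB ler_pdivlMl//; apply: (le_trans (hc _)).
by rewrite BK.
Qed.

(** [T - z] is bounded below by comparing [T^n] with [z^n] for large [n].  It is
onto because [y - z ^- n *: T^n y] is always in its range and the second term tends
to 0. *)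
Lemma iter_le_notin_spectrum (z : C) (s K : R) : 0 <= s -> s < rnorm z ->
  (forall n x, rnorm (iter n T x) <= K * s ^+ n * rnorm x) -> ~ spectrum T z.
Proof.
move=> s0 sz hK; have z0 : z != 0 by rewrite -rnorm_gt0 (le_lt_trans s0).
have K0 : 0 < `|K| + 1 by rewrite ltr_wpDl.
have hK' n x : rnorm (iter n T x) <= (`|K| + 1) * s ^+ n * rnorm x.
  apply: (le_trans (hK n x)); rewrite ler_wpM2r ?rnorm_ge0// ler_wpM2r ?exprn_ge0//.
  by rewrite (le_trans (ler_norm K))// lerDl.
have [c c0 hc] : exists2 c : R, 0 < c & bounded_below T z c.
  have [|N hN] := ratio_expr_lt s0 sz (_ : 0 < (`|K| + 1)^-1); first by rewrite invr_gt0.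
  apply: (bounded_below_of_iter_le bT (hK' N)).
  by have := hN N (leqnn N); rewrite ltr_pdivlMl.
apply: (bounded_below_onto_notin_spectrum c0 hc) => y.
apply: (bounded_below_closed_range bT c0 hc) => r r0.
have tel n : exists x, T x - (z : R[i]) *: x = y - ((z ^- n : C) : R[i]) *: iter n T y.
  elim: n => [|n [x hx]].
    by exists 0; rewrite raddf0 scaler0 expr0 invr1 scale1r !subrr.
  exists (x - ((z ^- n.+1 : C) : R[i]) *: iter n T y).
  rewrite shiftB hx [T (_ *: _)]linearZ/= scalerA exprS invfM mulrA divff// mul1r.
  by rewrite opprB addrA subrK -invfM -exprS.
have y0 : 0 < rnorm y + 1 by rewrite ltr_wpDl ?rnorm_ge0.
have [|N hN] := ratio_expr_lt s0 sz (_ : 0 < r / (`|K| + 1) / (rnorm y + 1)).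
  by rewrite !divr_gt0.
have [x hx] := tel N; exists x; rewrite hx addrAC subrr add0r rnormN rnormZ rnormV rnormX.
rewrite ltr_pdivrMl ?exprn_gt0 ?rnorm_gt0//.
apply: (le_lt_trans (hK' N y)).
apply: (@le_lt_trans _ _ ((`|K| + 1) * s ^+ N * (rnorm y + 1))).
  by rewrite ler_wpM2l ?lerDl// mulr_ge0 ?exprn_ge0// ltW.
rewrite -ltr_pdivlMr// -ltr_pdivlMl//; apply: lt_le_trans (hN N (leqnn N)) _.
by rewrite le_eqVlt; apply/orP; left; apply/eqP; ring.
Qed.

Lemma notin_spectrum_bounded_below (z : C) : ~ spectrum T z ->
  exists2 c : R, 0 < c & bounded_below T z c.
Proof.
move=> /contrapT[B [bB BK _]]; have [M M0 hM] := bounded_operatorP bB.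
by exists M^-1; rewrite ?invr_gt0// => x; rewrite ler_pdivrMl// -{1}(BK x).
Qed.

End Spectrum.

Section ShiftRadii.
Context {R : realType} {H : completeNormedModType R[i]}.
Local Notation C := R[i]^o.
Variables (dot : {dot H for conjugation R}) (hilbertH : is_hilbert dot).
Variables (e : nat -> H) (basis_e : orthonormal_basis dot e).
Variables (w : nat -> R) (w_gt0 : forall n, 0 < w n).
Variables (w_bounded : exists M : R, forall n, w n <= M).
Variables (S : {linear H -> H}) (shiftS : weighted_shift e w S).
Local Notation coef := (fourier dot e).
Local Notation beta := (weight_prod w).

Let bS : bounded_operator S := shiftS.1.
Let b0 n : 0 < beta n := weight_prod_gt0 w_gt0 n.

(** A coordinate of [x] is computed from finitely many coordinates of
[S x - z *: x] by forward substitution. *)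
Lemma fourier_le_shift (z : C) k : z != 0 -> exists L : R,
  forall x, rnorm (coef k x) <= L * rnorm (S x - (z : R[i]) *: x).
Proof.
move=> z0; have nz0 : 0 < rnorm z by rewrite rnorm_gt0.
elim: k => [|k [L hL]].
  exists (rnorm z)^-1 => x; rewrite ler_pdivlMl// -rnormM.
  have -> : z * coef 0 x = - coef 0 (S x - (z : R[i]) *: x).
    by rewrite fourierB fourierZ (fourier_shift0 hilbertH basis_e shiftS) sub0r opprK.
  by rewrite rnormN (fourier_le hilbertH basis_e).
exists ((w k * L + 1) / rnorm z) => x; rewrite mulrAC ler_pdivlMr// mulrC -rnormM.
have -> : z * coef k.+1 x = (w k)%:C%C * coef k x - coef k.+1 (S x - (z : R[i]) *: x).
  rewrite fourierB fourierZ (fourier_shiftS hilbertH basis_e w_gt0 shiftS).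
  by rewrite opprB addrC subrK.
apply: (le_trans (le_rnormB _ _)); rewrite mulrDl mul1r lerD//.
  by rewrite rnormM rnormr gtr0_norm// -mulrA ler_wpM2l// ltW.
exact: (fourier_le hilbertH basis_e).
Qed.

Lemma zero_in_spectrum : spectrum S 0.
Proof.
move=> [B [_ _ SB]]; have := SB (e 0); rewrite scale0r subr0 => h.
have := congr1 (coef 0) h; rewrite (fourier_shift0 hilbertH basis_e shiftS).
by rewrite (fourier_basis basis_e) eqxx => /eqP; rewrite eq_sym oner_eq0.
Qed.

(** Forward substitution gives the coordinates of the resolvent at [e k]: they
vanish before [k], and the one at [k + n] has norm
[beta (k + n) / beta k / rnorm z ^+ n.+1], which is at most the norm of the
resolvent. *)
Lemma notin_spectrum_growth (z : C) : ~ spectrum S z ->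
  exists2 K : R, 0 < K & forall k n, beta (k + n) <= K * rnorm z ^+ n * beta k.
Proof.
move=> zS; have z0 : z != 0.
  by apply: contra_notN zS => /eqP ->; exact: zero_in_spectrum.
have nz0 : 0 < rnorm z by rewrite rnorm_gt0.
have [B [bB _ SB]] := contrapT zS; have [M M0 hM] := bounded_operatorP bB.
exists (M * rnorm z); first by rewrite mulr_gt0.
move=> k n; pose c j := coef j (B (e k)).
have c0 : - (z * c 0) = (k == 0)%:R.
  rewrite -(fourier_basis basis_e) -{1}(SB (e k)) fourierB fourierZ.
  by rewrite (fourier_shift0 hilbertH basis_e shiftS) sub0r.
have cS j : (w j)%:C%C * c j - z * c j.+1 = (k == j.+1)%:R.
  rewrite -(fourier_basis basis_e) -{1}(SB (e k)) fourierB fourierZ.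
  by rewrite (fourier_shiftS hilbertH basis_e w_gt0 shiftS).
have clt j : (j < k)%N -> c j = 0.
  elim: j => [|j ih] jk.
    move: c0; rewrite gtn_eqF// => /eqP; rewrite oppr_eq0 mulf_eq0 (negPf z0).
    by move=> /eqP.
  have := cS j; rewrite ih ?(ltnW jk)// mulr0 sub0r gtn_eqF// => /eqP.
  by rewrite oppr_eq0 mulf_eq0 (negPf z0) => /eqP.
have cE m : rnorm z ^+ m.+1 * rnorm (c (k + m)%N) = beta (k + m) / beta k.
  elim: m => [|m ih].
    rewrite addn0 divff ?gt_eqF// expr1 -rnormM.
    suff -> : z * c k = -1 by rewrite rnormN rnorm1.
    apply/eqP; rewrite -eqr_oppLR; apply/eqP.
    case: (k) c0 cS clt => [-> //|k'] _ cS clt.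
    by have := cS k'; rewrite clt// mulr0 sub0r eqxx.
  have := cS (k + m)%N; rewrite -addnS ltn_eqF ?ltnS ?addnS ?leq_addr//.
  move=> /eqP; rewrite subr_eq0 => /eqP h.
  rewrite exprSr -mulrA -rnormM -h rnormM rnormr gtr0_norm// weight_prodS.
  by rewrite mulrCA ih mulrC mulrAC.
have := hM (e k); rewrite (rnorm_basis hilbertH basis_e) mulr1 => h.
have := le_trans (fourier_le hilbertH basis_e (k + n) _) h.
rewrite -(ler_pM2l (exprn_gt0 n.+1 nz0)) cE ler_pdivrMr// => /le_trans; apply.
by rewrite le_eqVlt exprS; apply/orP; left; apply/eqP; ring.
Qed.

Lemma growth_notin_spectrum (z : C) (s K : R) : 0 <= s -> 0 <= K -> s < rnorm z ->
  (forall k n, beta (k + n) <= K * s ^+ n * beta k) -> ~ spectrum S z.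
Proof.
move=> s0 K0 sz hK; apply: (iter_le_notin_spectrum bS s0 sz (K := K)) => n.
apply: (iter_shift_le hilbertH basis_e w_gt0 shiftS) => //.
by rewrite mulr_ge0// exprn_ge0.
Qed.

Lemma spectrum_has_sup : has_sup [set rnorm z | z in spectrum S].
Proof.
split; first by exists (rnorm (0 : C)), 0 => //; exact: zero_in_spectrum.
have [M hM] := w_bounded; have M0 : 0 <= M := le_trans (ltW (w_gt0 0)) (hM 0%N).
exists M => _ [z zS <-]; rewrite leNgt; apply/negP => Mz.
apply: (growth_notin_spectrum M0 ler01 Mz _ zS) => k n; rewrite mul1r.
elim: n => [|n ih]; first by rewrite addn0 expr0 mul1r.
rewrite addnS weight_prodS exprSr -mulrA [M * _]mulrC mulrA.
by rewrite ler_pM// ?ltW.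
Qed.

Lemma spectral_radius_ge0 : 0 <= spectral_radius S.
Proof.
rewrite -(@rnorm0 _ C); apply: (sup_upper_bound spectrum_has_sup).
by exists 0 => //; exact: zero_in_spectrum.
Qed.

Lemma spectral_radius_lt_notin (z : C) : spectral_radius S < rnorm z -> ~ spectrum S z.
Proof.
move=> rz zS; have : rnorm z <= spectral_radius S.
  by apply: (sup_upper_bound spectrum_has_sup); exists z.
by rewrite leNgt rz.
Qed.

Lemma growth_gt_spectral_radius (s : R) : spectral_radius S < s ->
  exists2 K : R, 0 < K & forall k n, beta (k + n) <= K * s ^+ n * beta k.
Proof.
move=> rs; have ns : rnorm (s%:C%C : C) = s.
  by rewrite rnormr gtr0_norm// (le_lt_trans spectral_radius_ge0).
have := @notin_spectrum_growth (s%:C%C); rewrite ns; apply.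
by apply: spectral_radius_lt_notin; rewrite ns.
Qed.

Lemma spectral_radius_le (s K : R) : 0 <= s -> 0 <= K ->
  (forall k n, beta (k + n) <= K * s ^+ n * beta k) -> spectral_radius S <= s.
Proof.
move=> s0 K0 hK; apply: ge_sup; first by case: spectrum_has_sup.
move=> _ [z zS <-]; rewrite leNgt; apply/negP => sz.
exact: (growth_notin_spectrum s0 K0 sz hK zS).
Qed.

Lemma lower_norm_le n x : lower_norm (iter n S) * rnorm x <= rnorm (iter n S x).
Proof.
have [->|x0] := eqVneq x 0; first by rewrite rnorm0 mulr0 rnorm_ge0.
have nx : 0 < rnorm x by rewrite rnorm_gt0.
have iterZ (a : R[i]) y : iter n S (a *: y) = a *: iter n S y.
  by elim: n => //= n ->; rewrite linearZ.
rewrite -ler_pdivlMr//; apply: ge_inf.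
  by exists 0 => _ [y _ <-]; exact: rnorm_ge0.
exists (((rnorm x)^-1)%:C%C *: x).
  by rewrite /= rnormZ rnormr gtr0_norm ?invr_gt0// mulVf// gt_eqF.
by rewrite iterZ rnormZ rnormr gtr0_norm ?invr_gt0// mulrC.
Qed.

Lemma lower_norm_ge n (q : R) : (forall x, q * rnorm x <= rnorm (iter n S x)) ->
  q <= lower_norm (iter n S).
Proof.
move=> hq; apply: lb_le_inf.
  by exists (rnorm (iter n S (e 0))), (e 0%N) => //=; exact: (rnorm_basis hilbertH basis_e).
by move=> _ [x /= x1 <-]; have := hq x; rewrite x1 mulr1.
Qed.

Lemma lower_norm_ge0 n : 0 <= lower_norm (iter n S).
Proof. by apply: lower_norm_ge => x; rewrite mul0r rnorm_ge0. Qed.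

(** Iterating the lower bound of [S^n] along the orbit of [e 0] gives a growth of
[beta] that the spectral radius limits; the constant [K] disappears in the limit
of large iterates. *)
Lemma lower_norm_le_growth (s : R) : spectral_radius S < s ->
  forall n, lower_norm (iter n S) <= s ^+ n.
Proof.
move=> rs n; have s0 : 0 < s := le_lt_trans spectral_radius_ge0 rs.
have [K K0 hK] := growth_gt_spectral_radius rs.
rewrite leNgt; apply/negP => sm.
have powm j : lower_norm (iter n S) ^+ j <= K * (s ^+ n) ^+ j.
  apply: (@le_trans _ _ (rnorm (iter (j * n) S (e 0%N)))).
    elim: j => [|j ih]; first by rewrite expr0 (rnorm_basis hilbertH basis_e).
    rewrite mulSn iterD exprS; apply: le_trans (lower_norm_le n _).
    by rewrite ler_wpM2l// lower_norm_ge0.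
  rewrite (rnorm_iter_shift_basis hilbertH basis_e w_gt0 shiftS) ler_pdivrMr//.
  by rewrite -exprM [(n * j)%N]mulnC; exact: hK.
have [|N hN] := ratio_expr_lt (exprn_ge0 n (ltW s0)) sm (_ : 0 < K^-1).
  by rewrite invr_gt0.
have := hN N (leqnn N); rewrite ltr_pdivlMl// => /lt_le_trans/(_ (powm N)).
by rewrite ltxx.
Qed.

Let powR_root_le (a b : R) n : 0 <= a -> 0 <= b -> (0 < n)%N ->
  (a `^ n%:R^-1 <= b) = (a <= b ^+ n).
Proof.
move=> a_ge0 b_ge0 n0; have nn : n%:R != 0 :> R by rewrite pnatr_eq0 -lt0n.
have aE : a = (a `^ n%:R^-1) ^+ n.
  by rewrite -powR_mulrn ?powR_ge0// -powRrM mulVf// powRr1.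
by rewrite [in RHS]aE ler_pXn2r// nnegrE powR_ge0.
Qed.

Lemma lower_root_le_spectral_radius n : (1 <= n)%N ->
  lower_norm (iter n S) `^ n%:R^-1 <= spectral_radius S.
Proof.
move=> n1; apply/ler_addgt0Pr => r r0.
rewrite powR_root_le ?lower_norm_ge0 ?addr_ge0 ?spectral_radius_ge0 ?(ltW r0)//.
by apply: lower_norm_le_growth; rewrite ltrDl.
Qed.

Let lower_set := [set lower_norm (iter n S) `^ n%:R^-1 | n in [set n | (1 <= n)%N]].

Let lower_has_sup : has_sup lower_set.
Proof.
split; first by exists (lower_norm (iter 1 S) `^ 1%:R^-1), 1%N.
by exists (spectral_radius S) => _ [n /= n1 <-]; exact: lower_root_le_spectral_radius.
Qed.

Lemma lower_le_spectral_radius : lower_radius S <= spectral_radius S.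
Proof.
apply: ge_sup; first by case: lower_has_sup.
by move=> _ [n /= n1 <-]; exact: lower_root_le_spectral_radius.
Qed.

Lemma lower_radius_ge0 : 0 <= lower_radius S.
Proof.
apply: (le_trans (powR_ge0 (lower_norm (iter 1 S)) 1%:R^-1)).
by apply: (sup_upper_bound lower_has_sup); exists 1%N.
Qed.

Lemma lower_radius_ge (s c : R) : 0 < s -> 0 < c ->
  (forall k n, c * s ^+ n * beta k <= beta (k + n)) -> s <= lower_radius S.
Proof.
move=> s0 c0 hc; rewrite leNgt; apply/negP => rs.
have [N hN] := ratio_expr_lt lower_radius_ge0 rs c0.
have {hN} := hN N.+1 (leqnSn N); rewrite ltNge => /negP; apply.
apply: (@le_trans _ _ (lower_norm (iter N.+1 S))).
  apply: lower_norm_ge; apply: (iter_shift_ge hilbertH basis_e w_gt0 shiftS) => //.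
  by rewrite mulr_ge0 ?exprn_ge0 ?ltW.
rewrite -powR_root_le ?lower_norm_ge0 ?lower_radius_ge0//.
by apply: (sup_upper_bound lower_has_sup); exists N.+1.
Qed.

Lemma lower_radius_gt (s : R) : 0 <= s -> s < lower_radius S ->
  exists n, s ^+ n < lower_norm (iter n S).
Proof.
move=> s0 sr; have [|_ [n /= n1 <-]] := @sup_gt R lower_set s _ sr.
  by case: lower_has_sup.
by move=> h; exists n; move: h; rewrite ltNge powR_root_le ?lower_norm_ge0// -ltNge.
Qed.

Lemma bounded_below_off_circle (z : C) : lower_radius S = spectral_radius S ->
  rnorm z != spectral_radius S -> exists2 c : R, 0 < c & bounded_below S z c.
Proof.
move=> rr; rewrite neq_lt => /orP[zr|rz].
  have [||n hn] := @lower_radius_gt (rnorm z); rewrite ?rnorm_ge0 ?rr//.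
  exact: (bounded_below_of_iter_ge bS (lower_norm_le n) hn).
exact: (notin_spectrum_bounded_below (spectral_radius_lt_notin rz)).
Qed.

End ShiftRadii.

(** * Closed range on annuli *)

Section DerivableSums.
Context {R : realType} {V : normedModType R[i]}.
Local Notation C := R[i]^o.

Lemma derivable_bigsum (I : Type) (s : seq I) (F : I -> C -> V) (z : C) :
  (forall i, derivable (F i) z 1) -> derivable (fun u => \sum_(i <- s) F i u) z 1.
Proof.
move=> dF; elim: s => [|i s ih].
  have -> : (fun u => \sum_(i <- [::]) F i u) = cst 0 by apply/funext => u; rewrite big_nil.
  exact: derivable_cst.
have -> : (fun u => \sum_(j <- i :: s) F j u) = F i + (fun u => \sum_(j <- s) F j u).
  by apply/funext => u; rewrite big_cons.
exact: derivableD.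
Qed.

Lemma derivable_monomial (a : C) m n (z : C) : z != 0 ->
  derivable (fun u : C => a * (u ^+ m * u^-1 ^+ n) : C) z 1.
Proof.
move=> z0.
have dI : derivable (id : C -> C) z 1 by exact: derivable_id.
have dM (f g : C -> C) : derivable f z 1 -> derivable g z 1 ->
    derivable (fun u => f u * g u : C) z 1.
  by move=> df dg; exact: (@derivableM _ _ f g z 1 df dg).
have dX (f : C -> C) k : derivable f z 1 -> derivable (fun u : C => f u ^+ k : C) z 1.
  move=> df; elim: k => [|k ih]; first exact: derivable_cst.
  have := dM _ _ df ih; congr (derivable _ z 1).
  by apply/funext => u; rewrite exprS.
apply: (dM (cst a)); first exact: derivable_cst.
apply: (dM (fun u : C => u ^+ m : C)); first exact: dX dI.
apply: (dX (fun u : C => u^-1 : C)).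
exact: (@derivableV _ _ (id : C -> C) z 1 z0 dI).
Qed.

End DerivableSums.

Section Annulus.
Context {R : realType} {H : completeNormedModType R[i]}.
Local Notation C := R[i]^o.
Variables (dot : {dot H for conjugation R}) (hilbertH : is_hilbert dot).
Variables (e : nat -> H) (basis_e : orthonormal_basis dot e).
Variables (w : nat -> R) (w_gt0 : forall n, 0 < w n).
Variables (S : {linear H -> H}) (shiftS : weighted_shift e w S).
Local Notation coef := (fourier dot e).
Local Notation beta := (weight_prod w).

Let bS : bounded_operator S := shiftS.1.
Let b0 n : 0 < beta n := weight_prod_gt0 w_gt0 n.

Definition annulus (a b : R) : set C := [set z | a < rnorm z < b].

Lemma open_annulus a b : open (annulus a b).
Proof.
rewrite openE => z /= /andP[az zb]; apply/nbhs_rnormP.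
exists (Num.min (rnorm z - a) (b - rnorm z)); first by rewrite lt_min !subr_gt0 az.
move=> u; rewrite lt_min => /andP[h1 h2]; apply/andP; split.
  by have := le_rnorm_dist z u; rewrite rnormB; lra.
by have := le_rnorm_dist u z; lra.
Qed.

(** A finite piece of the formal eigenvector [\sum_k beta k * z ^- k *: e k],
normalized so that its coefficient at [e j] is [d / z]. *)
Definition shift_window (d : R) p j q (z : C) : H :=
  \sum_(p <= k < q)
    ((d * (beta k / beta j))%:C%C * (z ^+ j * z^-1 ^+ k.+1) : R[i]) *: e k.

Lemma shift_window_shift (d : R) p j q (z : C) : z != 0 -> (p <= j <= q)%N ->
  S (shift_window d p j q z) - (z : R[i]) *: shift_window d p j q z =
  (z^-1 ^+ (q - j) : R[i]) *: ((d * (beta q / beta j))%:C%C *: e q) -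
  (z ^+ (j - p) : R[i]) *: ((d * (beta p / beta j))%:C%C *: e p).
Proof.
move=> z0 /andP[pj jq].
pose t k : H := ((d * (beta k / beta j))%:C%C * (z ^+ j * z^-1 ^+ k) : R[i]) *: e k.
transitivity (t q - t p).
  rewrite -(telescope_sumr t (leq_trans pj jq)) /shift_window linear_sum scaler_sumr -sumrB.
  apply: eq_bigr => k _; rewrite linearZ/= shiftS.2 !scalerA /t; congr (_ *: _ - _ *: _).
    by rewrite weight_prodS mulrA [in RHS]mulrAC !rmorphM/=; ring.
  rewrite exprS mulrCA; congr (_ * _); rewrite mulrCA; congr (_ * _).
  by rewrite mulrA divff// mul1r.
congr (_ - _); rewrite /t scalerA [in RHS]mulrC; congr ((_ * _) *: _).
  by rewrite -(subnKC jq) exprD mulrA -exprMn divff// expr1n mul1r addKn.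
by rewrite -{1}(subnK pj) exprD -mulrA -exprMn divff// expr1n mulr1.
Qed.

(** Suppose no [K] works, and choose for each [i] a window on which the estimate
fails for [K = 4 ^+ i].  Scaled by [d = 2 ^+ i], the image of this window under
[S - z] is at most a multiple of [2 ^- i] on the whole annulus.  The sum of these
images is a power series in [z] plus one in [z^-1], hence analytic, and it is in
the closure of the range.  At a positive real point all the windows have
nonnegative coefficients, so a preimage of the sum would have a coefficient at
least [2 ^+ i / z] for every [i]. *)
Lemma closed_range_annulus (a b : R) : 0 < a -> a < b ->
  closed_range_on S (annulus a b) ->
  exists2 K : R, 0 < K & forall p j q, (p <= j <= q)%N ->
    beta j <= K * beta p * b ^+ (j - p) \/ beta j * a ^+ (q - j) <= K * beta q.
Proof.
move=> a0 ab /closed_range_onP cr; apply: contrapT => nK.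
have bgt0 : 0 < b := lt_trans a0 ab.
have ex i : exists pjq : nat * nat * nat,
    [/\ (pjq.1.1 <= pjq.1.2)%N, (pjq.1.2 < pjq.2)%N,
      2 ^+ i * 2 ^+ i * beta pjq.1.1 * b ^+ (pjq.1.2 - pjq.1.1) < beta pjq.1.2 &
      2 ^+ i * 2 ^+ i * beta pjq.2 < beta pjq.1.2 * a ^+ (pjq.2 - pjq.1.2)].
  apply: contrapT => nex; apply: nK; exists (2 ^+ i * 2 ^+ i).
    by rewrite mulr_gt0 ?exprn_gt0.
  move=> p j q /andP[pj jq]; apply: contrapT => /not_orP[/negP h1 /negP h2].
  rewrite -ltNge in h1; rewrite -ltNge in h2.
  apply: nex; exists (p, j, q); split=> //=; rewrite ltn_neqAle jq andbT.
  (* [j = q] is excluded because the constant [4 ^+ i] is at least 1; thus the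
     window contains the index [j]. *)
  apply/eqP => jqE; move: h2; rewrite jqE subnn expr0 mulr1 gtr_pMl// => h2.
  by have : 1 <= 2 ^+ i * 2 ^+ i :> R; [rewrite mulr_ege1 ?exprn_ege1 ?ler1n|rewrite leNgt h2].
have [pjq hpjq] := choice ex.
pose P i := (pjq i).1.1; pose J i := (pjq i).1.2; pose Q i := (pjq i).2.
have PJ i : (P i <= J i)%N by have [] := hpjq i.
have JQ i : (J i < Q i)%N by have [] := hpjq i.
have pow2 i : 0 < 2 ^+ i :> R by rewrite exprn_gt0.
pose c1 i : H := (2 ^+ i * (beta (Q i) / beta (J i)))%:C%C *: e (Q i).
pose c2 i : H := (2 ^+ i * (beta (P i) / beta (J i)))%:C%C *: e (P i).
have n1 (r : R) k : 0 <= r -> rnorm (r%:C%C *: e k) = r.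
  by move=> r0; rewrite rnormZ rnormr (rnorm_basis hilbertH basis_e) mulr1 ger0_norm.
have [||G1 [G1s G1d]] := @power_series_derivable _ _ c1 (fun i => Q i - J i)%N a^-1.
- by rewrite invr_gt0.
- move=> i; rewrite n1; last by rewrite mulr_ge0 ?divr_ge0 ?ltW.
  have [_ _ _ h] := hpjq i; rewrite -/(J i) -/(Q i) in h.
  rewrite [a^-1 ^+ _]exprVn ler_pdivrMr ?exprn_gt0// exprVn mulrA ler_pdivrMr//.
  by rewrite -[leRHS]mulrA ler_pdivlMl// mulrA [leRHS]mulrC ltW.
have [||G2 [G2s G2d]] := @power_series_derivable _ _ c2 (fun i => J i - P i)%N b.
- by [].
- move=> i; rewrite n1; last by rewrite mulr_ge0 ?divr_ge0 ?ltW.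
  have [_ _ h _] := hpjq i; rewrite -/(J i) -/(P i) in h.
  by rewrite exprVn -[leRHS]mulr1 ler_pdivlMl// !mulrA mulrAC ler_pdivrMr// mul1r ltW.
pose U := annulus a b.
have oU : open U := @open_annulus a b.
have U0 z : U z -> z != 0 by move=> /andP[az _]; rewrite -rnorm_gt0 (lt_trans a0).
pose F n z := \sum_(i < n) shift_window (2 ^+ i) (P i) (J i) (Q i) z.
pose g z := G1 z^-1 - G2 z.
have Fg n z : U z -> rnorm (S (F n z) - (z : R[i]) *: F n z - g z) <= 4 * 2^-1 ^+ n.
  move=> Uz; have /andP[az zb] := Uz.
  pose s1 := \sum_(i < n) (z^-1 ^+ (Q i - J i) : R[i]) *: c1 i.
  pose s2 := \sum_(i < n) (z ^+ (J i - P i) : R[i]) *: c2 i.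
  have -> : S (F n z) - (z : R[i]) *: F n z = s1 - s2.
    rewrite /F linear_sum scaler_sumr -!sumrB; apply: eq_bigr => i _.
    by rewrite shift_window_shift ?U0// PJ ltnW.
  have -> : s1 - s2 - g z = - (G1 z^-1 - s1) + (G2 z - s2).
    by rewrite /g !opprB [G2 z - G1 _]addrC addrACA [- s2 + _]addrC.
  apply: (le_trans (le_rnormD _ _)); rewrite rnormN.
  have h1 : rnorm (z^-1 : C) <= a^-1.
    by rewrite rnormV lef_pV2 ?posrE ?ltW// (lt_trans a0).
  have := G1s _ n h1; have := G2s _ n (ltW zb); rewrite -/s1 -/s2; lra.
have dF n z : U z -> derivable (F n) z 1.
  move=> /U0 z0; apply: derivable_bigsum => i; apply: derivable_bigsum => k.
  exact/derivable_scalev/derivable_monomial.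
have dg z : U z -> derivable g z 1.
  move=> Uz; have z0 := U0 z Uz; have /andP[az zb] := Uz.
  apply: (@derivableB _ _ _ (fun u : C => G1 u^-1) G2); last exact: G2d.
  apply/derivable1_diffP; apply: (@differentiable_comp _ _ _ _ (fun u : C => u^-1 : C) G1).
    apply/derivable1_diffP.
    have dI : derivable (id : C -> C) z 1 by exact: derivable_id.
    exact: (@derivableV _ _ (id : C -> C) z 1 z0 dI).
  apply/derivable1_diffP; apply: G1d; rewrite rnormV ltf_pV2 ?posrE//.
  exact: lt_trans az.
have half01 : 0 <= (2^-1 : R) < 1 by apply/andP; split; lra.
have [||f Af fg] := cr (extend0 U g); first exact: extend0_analytic.
  move=> K cK KU r r0.
  have [|N hN] := expr_eventually_lt half01 (_ : 0 < r / 4); first by rewrite divr_gt0.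
  exists (extend0 U (F N)); first by apply: extend0_analytic => // z; exact: dF.
  move=> z /KU Uz; rewrite /pointwise_shift !extend0E//.
  apply: (le_lt_trans (Fg N z Uz)); have := hN N (leqnn N); lra.
(* A positive real point of the annulus. *)
pose c := (a + b) / 2.
have c0 : 0 < c by rewrite divr_gt0// addr_gt0.
pose zc : C := c%:C%C.
have nzc : rnorm zc = c by rewrite rnormr gtr0_norm.
have Uzc : U zc by rewrite /U /annulus /= nzc; apply/andP; split; rewrite /c; lra.
have big i : 2 ^+ i / c <= rnorm (f zc) + 1.
  have [L hL] := fourier_le_shift hilbertH basis_e w_gt0 shiftS (J i) (U0 _ Uzc).
  have L0 : 0 < 4 * (`|L| + 1) by rewrite mulr_gt0// ltr_wpDl.
  have [|N hN] := expr_eventually_lt half01 (_ : 0 < (4 * (`|L| + 1))^-1).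
    by rewrite invr_gt0.
  pose n := maxn N i.+1.
  (* Coordinates depend continuously on the image under [S - z], so those of [f]
     are the limits of those of the partial sums [F n]. *)
  have small : rnorm (coef (J i) (F n zc - f zc)) <= 1.
    apply: (le_trans (hL _)); rewrite shiftB.
    have := fg zc Uzc; rewrite /pointwise_shift extend0E// => ->.
    have := hN n (leq_maxl _ _); rewrite -(ltr_pM2l L0) mulfV ?gt_eqF// => h.
    apply: (@le_trans _ _ ((`|L| + 1) * (4 * 2^-1 ^+ n))).
      apply: (@le_trans _ _ ((`|L| + 1) * rnorm (S (F n zc) - (zc : R[i]) *: F n zc - g zc))).
        by rewrite ler_wpM2r ?rnorm_ge0// (le_trans (ler_norm L))// lerDl.
      by rewrite ler_wpM2l ?Fg// ler_wpDl.
    by rewrite mulrA [_ * 4]mulrC ltW.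
  pose psi i' k : R := 2 ^+ i' * (beta k / beta (J i')) * (c ^+ J i' * c^-1 ^+ k.+1).
  have psi0 i' k : 0 <= psi i' k.
    by rewrite !mulr_ge0 ?divr_ge0 ?exprn_ge0 ?invr_ge0// ltW.
  have coefF : coef (J i) (F n zc) =
      (\sum_(i' < n) \sum_(P i' <= k < Q i') psi i' k * (k == J i)%:R)%:C%C.
    rewrite /F fourier_sum (rmorph_sum (real_complex R))/=; apply: eq_bigr => i' _.
    rewrite /shift_window fourier_sum (rmorph_sum (real_complex R))/=; apply: eq_bigr => k _.
    rewrite fourierZ (fourier_basis basis_e) /psi /zc.
    rewrite [RHS](rmorphM (real_complex R)) (rmorph_nat (real_complex R)); congr (_ * _).
    rewrite [RHS](rmorphM (real_complex R)); congr (_ * _).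
    rewrite [RHS](rmorphM (real_complex R)) !(rmorphXn (real_complex R)).
    by rewrite (fmorphV (real_complex R)).
  have in_ : (i < n)%N by exact: leq_maxr.
  (* Keep only the window number [i] and its coefficient at [J i]. *)
  have term : 2 ^+ i / c <= \sum_(i' < n) \sum_(P i' <= k < Q i') psi i' k * (k == J i)%:R.
    rewrite (bigD1 (Ordinal in_))//= -[leLHS]addr0 lerD//; last first.
      by apply: sumr_ge0 => i' _; apply: sumr_ge0 => k _; rewrite mulr_ge0.
    rewrite (bigD1_seq (J i)) ?iota_uniq//=; last by rewrite mem_index_iota PJ JQ.
    rewrite eqxx mulr1 -[leLHS]addr0 lerD//; last first.
      by apply: sumr_ge0 => k _; rewrite mulr_ge0.
    rewrite /psi divff ?gt_eqF// mulr1.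
    suff -> : c ^+ J i * c^-1 ^+ (J i).+1 = c^-1 by [].
    by rewrite exprSr mulrA -exprMn divff ?gt_eqF// expr1n mul1r.
  have := Re_le_rnorm (coef (J i) (F n zc)); rewrite {1}coefF /=.
  move=> h; apply: (le_trans term); apply: (le_trans h).
  apply: (le_trans (le_rnorm_dist _ (coef (J i) (f zc)))); rewrite -fourierB addrC.
  by rewrite lerD// (fourier_le hilbertH basis_e).
have X0 : 0 < c * (rnorm (f zc) + 1) by rewrite mulr_gt0// ltr_wpDl ?rnorm_ge0.
have [|N hN] := expr_eventually_lt half01 (_ : 0 < (c * (rnorm (f zc) + 1))^-1).
  by rewrite invr_gt0.
have := hN N (leqnn N); rewrite exprVn ltf_pV2 ?posrE// ltNge => /negP; apply.
by have := big N; rewrite ler_pdivrMr// mulrC.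
Qed.

End Annulus.

(** * Bishop's property of a weighted shift *)

Section ShiftBishop.
Context {R : realType} {H : completeNormedModType R[i]}.
Local Notation C := R[i]^o.
Variables (dot : {dot H for conjugation R}) (hilbertH : is_hilbert dot).
Variables (e : nat -> H) (basis_e : orthonormal_basis dot e).
Variables (w : nat -> R) (w_gt0 : forall n, 0 < w n).
Variables (w_bounded : exists M : R, forall n, w n <= M).
Variables (S : {linear H -> H}) (shiftS : weighted_shift e w S).
Local Notation beta := (weight_prod w).

Let bS : bounded_operator S := shiftS.1.
Let beta_gt0 n : 0 < beta n := weight_prod_gt0 w_gt0 n.

(** The finitely many remaining indices are added one at a time, at the price of a
smaller constant. *)
Lemma growth_from_tail (s : R) N : 0 < s ->
  (exists2 c : R, 0 < c &
     forall k n, (N <= k)%N -> c * s ^+ n * beta k <= beta (k + n)) ->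
  exists2 c : R, 0 < c & forall k n, c * s ^+ n * beta k <= beta (k + n).
Proof.
move=> s0; elim: N => [[c c0 hc]|N ih [c c0 hc]].
  by exists c => // k n; exact: hc.
apply: ih; exists (Num.min c (Num.min 1 (c * w N / s))).
  by rewrite !lt_min c0 ltr01 divr_gt0// mulr_gt0.
move=> k n; rewrite leq_eqVlt => /orP[/eqP <-|Nk]; last first.
  apply: le_trans (hc k n Nk); rewrite !ler_wpM2r ?exprn_ge0 ?(ltW (beta_gt0 k)) ?(ltW s0)//.
  by rewrite ge_min lexx.
case: n => [|n].
  rewrite expr0 mulr1 addn0 ler_piMl ?(ltW (beta_gt0 N))//.
  by rewrite !ge_min lexx/= orbT.
apply: (@le_trans _ _ (c * w N / s * s ^+ n.+1 * beta N)).
  rewrite !ler_wpM2r ?exprn_ge0 ?(ltW (beta_gt0 N)) ?(ltW s0)//.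
  by rewrite !ge_min lexx !orbT.
have := hc N.+1 n (leqnn _); rewrite addSnnS weight_prodS; apply: le_trans.
rewrite le_eqVlt; apply/orP; left; apply/eqP; rewrite exprS.
by field; rewrite gt_eqF.
Qed.

Lemma bishop_beta_radii : bishop_beta S -> lower_radius S = spectral_radius S.
Proof.
move=> betaS; apply/eqP; rewrite eq_le.
rewrite (lower_le_spectral_radius hilbertH basis_e w_gt0 w_bounded shiftS)/= leNgt.
apply/negP => rr.
have r1_ge0 := lower_radius_ge0 hilbertH basis_e w_gt0 w_bounded shiftS.
set r1 := lower_radius S in rr r1_ge0; set r := spectral_radius S in rr.
(* Two disjoint annuli, of radii [a0 < b0] and [a < b], between [r1] and [r]. *)
pose d := (r - r1) / 5.
have d0 : 0 < d by rewrite divr_gt0// subr_gt0.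
pose a0 := r1 + d; pose b0 := r1 + 2 * d; pose a := r1 + 3 * d; pose b := r1 + 4 * d.
have br : b < r by rewrite /b /d; lra.
have a0_gt0 : 0 < a0 by rewrite ltr_wpDl.
have ab0 : a0 < b0 by rewrite /a0 /b0; lra.
have b0a : b0 < a by rewrite /a /b0; lra.
have ab : a < b by rewrite /a /b; lra.
have cr u v : closed_range_on S (annulus u v) by have [] := betaS _ (@open_annulus _ u v).
have ann u v : 0 < u -> u < v -> _ := fun u0 uv =>
  closed_range_annulus hilbertH basis_e w_gt0 shiftS u0 uv (cr u v).
have [K1 K10 hK1] := ann _ _ a0_gt0 ab0.
have b0_gt0 := lt_trans a0_gt0 ab0; have a_gt0 := lt_trans b0_gt0 b0a.
have [K2 K20 hK2] := ann _ _ a_gt0 ab.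
have b_gt0 := lt_trans a_gt0 ab.
(* The growth rate [b] is exceeded somewhere, even by the factor [K2]. *)
have [p [m rise]] : exists p m, K2 * b ^+ m * beta p < beta (p + m).
  apply: contrapT => nrise; move: br; rewrite ltNge => /negP; apply.
  apply: (spectral_radius_le hilbertH basis_e w_gt0 w_bounded shiftS (ltW b_gt0) (ltW K20)).
  move=> k n; rewrite leNgt; apply/negP => h; apply: nrise; by exists k, n.
set N := (p + m)%N in rise.
have after q : (N <= q)%N -> beta N * a ^+ (q - N) <= K2 * beta q.
  move=> Nq; have [|h|//] := hK2 p N q; first by rewrite leq_addr.
  by move: h; rewrite addKn mulrAC leNgt rise.
suff : exists2 c : R, 0 < c & forall k n, (N <= k)%N -> c * a0 ^+ n * beta k <= beta (k + n).
  move=> /(growth_from_tail a0_gt0)[c c0 hc].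
  have := lower_radius_ge hilbertH basis_e w_gt0 w_bounded shiftS a0_gt0 c0 hc.
  by rewrite -/r1 /a0; lra.
exists (Num.min K1^-1 (K1 * K2)^-1); first by rewrite lt_min !invr_gt0 K10 mulr_gt0.
move=> k n Nk; have a0n : 0 <= a0 ^+ n by rewrite exprn_ge0// ltW.
have [|h|h] := hK1 N k (k + n)%N; first by rewrite Nk leq_addr.
(* Between [N] and [k] the growth is at most of rate [b0], but at least of rate
   [a] between [N] and [k + n]; the part after [k] makes up for the difference. *)
- apply: (@le_trans _ _ ((K1 * K2)^-1 * a0 ^+ n * beta k)).
    by rewrite !ler_wpM2r// ?(ltW (beta_gt0 k))// ge_min lexx orbT.
  rewrite -mulrA ler_pdivrMl ?mulr_gt0// -mulrA.
  have Nkn : (N <= k + n)%N by rewrite (leq_trans Nk)// leq_addr.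
  apply: le_trans (ler_wpM2l (ltW K10) (after (k + n)%N Nkn)).
  rewrite -addnBAC// exprD.
  apply: (@le_trans _ _ (a0 ^+ n * (K1 * beta N * b0 ^+ (k - N)))).
    by rewrite ler_wpM2l.
  have -> : K1 * (beta N * (a ^+ (k - N) * a ^+ n)) =
     a ^+ n * (K1 * beta N * a ^+ (k - N)) by ring.
  have KN : 0 <= K1 * beta N by rewrite mulr_ge0 ?ltW.
  apply: ler_pM => //; first by rewrite mulr_ge0// exprn_ge0// ltW.
    by rewrite lerXn2r ?nnegrE ?ltW// (lt_trans ab0).
  by rewrite ler_wpM2l// lerXn2r ?nnegrE ?ltW.
- apply: (@le_trans _ _ (K1^-1 * a0 ^+ n * beta k)).
    by rewrite !ler_wpM2r// ?(ltW (beta_gt0 k))// ge_min lexx.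
  by rewrite -mulrA ler_pdivrMl// mulrC; move: h; rewrite addKn.
Qed.

Lemma bishop_beta_at_bounded_below (z : C) (c : R) : 0 < c ->
  bounded_below S z c -> bishop_beta_at S z.
Proof.
move=> c0 hc; exists (ball_ (@rnorm R _) z (c / 2)).
have openV : open (ball_ (@rnorm R C) z (c / 2)).
  rewrite openE => u /= zu; apply/nbhs_rnormP.
  exists (c / 2 - rnorm (z - u)); first by rewrite subr_gt0.
  move=> v uv /=; have := le_rnorm_distD z u v.
  by rewrite [rnorm (u - v)]rnormB; lra.
split; first by split=> //=; rewrite subrr rnorm0 divr_gt0.
move=> U oU UV; apply: (bounded_below_beta_on bS _ oU (c := c / 2)) => [|u /UV /= zu].
  by rewrite divr_gt0.
by apply: bounded_below_near hc _ _; rewrite rnormB ltW.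
Qed.

(** With [W e_k = a ^- k *: e_k], the operators [S \o W] and [a *: (W \o S)] agree
on the basis. *)
Lemma bishop_beta_at_circular (z z0 : C) : rnorm z0 = rnorm z ->
  bishop_beta_at S z -> bishop_beta_at S z0.
Proof.
have [->|z_neq0] := eqVneq z 0; first by rewrite rnorm0 => /rnorm0_eq0 ->.
move=> nz; pose a := z0 / z.
have nz_neq0 : rnorm z != 0 by rewrite gt_eqF// rnorm_gt0.
have a1 : rnorm a = 1 by rewrite rnormM rnormV nz divff.
have a_neq0 : a != 0 by rewrite -rnorm_gt0 a1.
have [|W [W1 We]] := diagonal_operator hilbertH basis_e (a := fun k => a^-1 ^+ k).
  by move=> k; rewrite rnormX rnormV a1 invr1 expr1n.
have [|W' [W'1 W'e]] := diagonal_operator hilbertH basis_e (a := fun k => a ^+ k).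
  by move=> k; rewrite rnormX a1 expr1n.
have bW : bounded_operator W by exists 1 => x; rewrite mul1r.
have bW' : bounded_operator W' by exists 1 => x; rewrite mul1r.
have bcomp (A B : {linear H -> H}) : bounded_operator A -> bounded_operator B ->
    bounded_operator (A \o B).
  move=> /bounded_operatorP[M M0 hM] /bounded_operatorP[M' M'0 hM'].
  exists (M * M') => x; apply: (le_trans (hM _)).
  by rewrite -mulrA ler_wpM2l// ltW.
have bid : bounded_operator (idfun : H -> H) by exists 1 => x; rewrite mul1r.
have WK : cancel W W'.
  apply: (bounded_eq_on_basis basis_e (A := W' \o W) (B := idfun)) => //.
    exact: bcomp.
  by move=> k /=; rewrite We linearZ/= W'e scalerA -exprMn mulVf// expr1n scale1r.
have W'K : cancel W' W.
  apply: (bounded_eq_on_basis basis_e (A := W \o W') (B := idfun)) => //.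
    exact: bcomp.
  by move=> k /=; rewrite W'e linearZ/= We scalerA -exprMn divff// expr1n scale1r.
have SW x : S (W x) = (a : R[i]) *: W (S x).
  apply: (bounded_eq_on_basis basis_e (A := S \o W)
            (B := (a : R[i]) \*: (W \o S))) => [||k /=].
  - exact: bcomp.
  - have [M hM] := bcomp W S bW bS; exists M => y /=.
    by rewrite rnormZ a1 mul1r; exact: hM.
  rewrite We [S (_ *: _)]linearZ/= shiftS.2 [W (_ *: _)]linearZ/= We !scalerA exprS.
  congr (_ *: _).
  by rewrite [a * _]mulrC -[RHS]mulrA mulVKf// mulrC.
have -> : z0 = a * z by rewrite divfK.
exact: (bishop_beta_at_rotate a1 W1 W'1 WK W'K SW).
Qed.

Lemma sigma_beta_of_equal_radii : lower_radius S = spectral_radius S ->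
  bishop_beta S \/ sigma_beta S = [set z : C | rnorm z = spectral_radius S].
Proof.
move=> rr.
have off (z : C) : rnorm z != spectral_radius S -> bishop_beta_at S z.
  move=> /(bounded_below_off_circle hilbertH basis_e w_gt0 w_bounded shiftS rr)[c c0].
  exact: bishop_beta_at_bounded_below.
have [[z0 z0_sigma]|nosigma] := pselect (exists z, sigma_beta S z); last first.
  left; apply: bishop_beta_local => z; apply: contrapT => hz.
  by apply: nosigma; exists z.
have on z : sigma_beta S z -> rnorm z = spectral_radius S.
  by move=> hz; apply/eqP; apply: contra_notT hz; exact: off.
right; apply/seteqP; split=> [z|z /= nz]; first exact: on.
move=> hz; apply: (z0_sigma); apply: (bishop_beta_at_circular _ hz).
by rewrite nz on.
Qed.

End ShiftBishop.

Theorem theorem3p8 (R : realType) (H : completeNormedModType R[i])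
    (dot : {dot H for conjugation R}) (hilbertH : is_hilbert dot)
    (e : nat -> H) (basis_e : orthonormal_basis dot e)
    (w : nat -> R) (w_gt0 : forall n, 0 < w n)
    (w_bounded : exists M : R, forall n, w n <= M)
    (S : {linear H -> H}) (shiftS : weighted_shift e w S) :
  (bishop_beta S -> lower_radius S = spectral_radius S) /\
  (lower_radius S = spectral_radius S ->
     bishop_beta S \/
     sigma_beta S = [set z : R[i]^o | rnorm z = spectral_radius S]).
Proof.
split; first exact: (bishop_beta_radii hilbertH basis_e w_gt0 w_bounded shiftS).
exact: (sigma_beta_of_equal_radii hilbertH basis_e w_gt0 w_bounded shiftS).
Qed.
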